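(* Let $\mathfrak g=\mathrm T^*\mathfrak h_3$ with basis $e_1,\dots,e_6$ and non-zero commutators $[e_1,e_2]=e_6$, $[e_1,e_3]=-e_5$, $[e_2,e_3]=e_4$. The nilsolitons (algebraic Ricci soliton left invariant metrics) on $\mathfrak g$ are (up to isometry): (i) expanding, with $\gamma=-\frac5{2\lambda^2}$, in case of the metric $(S,0,E_{30})$ with $S=\mathrm{diag}(\lambda,\lambda,\lambda)$; (ii) shrinking, with $\gamma=\frac5{2\lambda^2}$, in case of the metric $(S,0,E_{21})$ with $S=\mathrm{diag}(\lambda,\lambda,-\lambda)$; (iii) steady, with $\gamma=0$, in case of the metrics $(S^1,M^2,\pm E_{20})$, $(S^k,M^2,E_{11})$ ($k=1,2,3$), or $(\pm E_{10},M^1,\pm E_{10})$, where $$S^1=\begin{pmatrix}0&0&0\\0&s_{22}&0\\0&0&s_{33}\end{pmatrix},\ S^2=\begin{pmatrix}0&0&0\\0&s_{22}&\frac12|s_{22}|\\0&\frac12|s_{22}|&0\end{pmatrix},\ S^3=\begin{pmatrix}0&0&0\\0&0&\frac12|s_{33}|\\0&\frac12|s_{33}|&s_{33}\end{pmatrix},$$ $$M^1=\begin{pmatrix}0&\lambda&0\\1&0&0\\1&0&0\end{pmatrix},\quad M^2=\begin{pmatrix}1&0&0\\0&0&0\\0&0&0\end{pmatrix}.$$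
   Context: A left invariant metric is identified with a non-degenerate symmetric bilinear form on $\mathfrak g$. The triple $(S,M,E)$ denotes the metric with Gram matrix $\begin{pmatrix}S&M\\ M^T&E\end{pmatrix}$ in the basis $e$; parameters are real and such that it is non-degenerate (so $\lambda\neq0$, $s_{22}\ne0$, $s_{33}\ne0$). Notation: $E_{30}=I$, $E_{21}=\mathrm{diag}(1,1,-1)$, $E_{20}=\mathrm{diag}(0,1,1)$, $E_{11}=\mathrm{diag}(0,1,-1)$, $E_{10}=\mathrm{diag}(0,0,1)$. A left invariant metric is an algebraic Ricci soliton if its Ricci operator satisfies $\mathrm{Ric}=\gamma I+D$ with $\gamma\in\mathbb R$ and $D$ a derivation of the Lie algebra; it is shrinking, steady or expanding according to $\gamma>0$, $\gamma=0$ or $\gamma<0$. Two left invariant metrics on $\mathfrak g$ are isometric iff they are related by an automorphism of $\mathfrak g$.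
   Formalization: The printed list is incomplete; the theorem adds the missing nilsolitons: (diag(λ,λ,λ),0,−E30), (diag(λ,λ,−λ),0,−E21), one more S (block a,b;b,−a) with M², E11, two further steady types with ±E10, and (0,M,0) with M invertible, and proves this enlarged list complete. *)

(* Defs.v *)
From mathcomp Require Import all_boot all_order all_algebra.
From mathcomp Require Import reals.

Set Implicit Arguments.
Unset Strict Implicit.
Unset Printing Implicit Defensive.

Import Order.TTheory GRing.Theory Num.Theory.
Local Open Scope ring_scope.

Section CotangentHeisenberg.
Variable R : realType.

(* Elements of the Lie algebra are coordinate columns in the basis e_1 .. e_6,
   endomorphisms are matrices acting on the left, bilinear forms are Gram
   matrices. The index k of [e k] and [coord x k] runs from 1 to 6. *)
Notation alg := 'cV[R]_6.

Definition e (k : nat) : alg := delta_mx (inord k.-1) 0.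
Definition coord (x : alg) (k : nat) : R := x (inord k.-1) 0.

Definition bracket (x y : alg) : alg :=
  (coord x 1 * coord y 2 - coord x 2 * coord y 1) *: e 6
  - (coord x 1 * coord y 3 - coord x 3 * coord y 1) *: e 5
  + (coord x 2 * coord y 3 - coord x 3 * coord y 2) *: e 4.

Definition derivation (D : 'M[R]_6) : Prop :=
  forall x y : alg,
    D *m bracket x y = bracket (D *m x) y + bracket x (D *m y).

Definition automorphism (A : 'M[R]_6) : Prop :=
  A \in unitmx /\
  forall x y : alg, A *m bracket x y = bracket (A *m x) (A *m y).

Definition is_metric (g : 'M[R]_6) : Prop := g^T = g /\ g \in unitmx.

(* For left invariant metrics on this algebra, isometric means related by an
   automorphism of the algebra. *)
Definition isometric (g h : 'M[R]_6) : Prop :=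
  exists2 A : 'M[R]_6, automorphism A & g = A^T *m h *m A.

Definition inner (g : 'M[R]_6) (x y : alg) : R := (x^T *m g *m y) 0 0.

(* Koszul formula for left invariant fields:
   2 g(nabla_x y, z) = g([x,y],z) - g([y,z],x) + g([z,x],y). *)
Definition koszul (g : 'M[R]_6) (x y z : alg) : R :=
  inner g (bracket x y) z - inner g (bracket y z) x + inner g (bracket z x) y.

Definition nabla (g : 'M[R]_6) (x y : alg) : alg :=
  invmx g *m (\col_k (koszul g x y (delta_mx k 0) / 2)).

Definition curvature (g : 'M[R]_6) (x y z : alg) : alg :=
  nabla g x (nabla g y z) - nabla g y (nabla g x z) - nabla g (bracket x y) z.

(* ric(x,y) is the trace of z |-> R(z,x)y. *)
Definition ricci_tensor (g : 'M[R]_6) (x y : alg) : R :=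
  \sum_k curvature g (delta_mx k 0) x y k 0.

(* g(Ric x, y) = ric(x,y). *)
Definition ricci_operator (g : 'M[R]_6) : 'M[R]_6 :=
  invmx g *m \matrix_(i, j) ricci_tensor g (delta_mx j 0) (delta_mx i 0).

Definition nilsoliton (g : 'M[R]_6) (gamma : R) : Prop :=
  is_metric g /\
  exists2 D : 'M[R]_6, derivation D & ricci_operator g = gamma%:M + D.

Definition expanding (g : 'M[R]_6) (gamma : R) : Prop :=
  nilsoliton g gamma /\ gamma < 0.
Definition shrinking (g : 'M[R]_6) (gamma : R) : Prop :=
  nilsoliton g gamma /\ 0 < gamma.
Definition steady (g : 'M[R]_6) (gamma : R) : Prop :=
  nilsoliton g gamma /\ gamma = 0.

Definition metric (S M E : 'M[R]_3) : 'M[R]_6 := block_mx S M M^T E.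

Definition mx3 (rows : seq (seq R)) : 'M[R]_3 :=
  \matrix_(i, j) (nth [::] rows i)`_j.
Definition diag3 (a b c : R) : 'M[R]_3 :=
  mx3 [:: [:: a; 0; 0]; [:: 0; b; 0]; [:: 0; 0; c]].

Definition E30 : 'M[R]_3 := diag3 1 1 1.
Definition E21 : 'M[R]_3 := diag3 1 1 (-1).
Definition E20 : 'M[R]_3 := diag3 0 1 1.
Definition E11 : 'M[R]_3 := diag3 0 1 (-1).
Definition E10 : 'M[R]_3 := diag3 0 0 1.

Definition S1 (s22 s33 : R) : 'M[R]_3 := diag3 0 s22 s33.
Definition S2 (s22 : R) : 'M[R]_3 :=
  mx3 [:: [:: 0; 0; 0]; [:: 0; s22; `|s22| / 2]; [:: 0; `|s22| / 2; 0]].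
Definition S3 (s33 : R) : 'M[R]_3 :=
  mx3 [:: [:: 0; 0; 0]; [:: 0; 0; `|s33| / 2]; [:: 0; `|s33| / 2; s33]].
Definition M1 (l : R) : 'M[R]_3 :=
  mx3 [:: [:: 0; l; 0]; [:: 1; 0; 0]; [:: 1; 0; 0]].
Definition M2 : 'M[R]_3 := diag3 1 0 0.

Inductive family_i : 'M[R]_6 -> R -> Prop :=
| Family_i (l : R) : l != 0 ->
    family_i (metric (diag3 l l l) 0 E30) (- (5 / (2 * l ^+ 2))).

Inductive family_ii : 'M[R]_6 -> R -> Prop :=
| Family_ii (l : R) : l != 0 ->
    family_ii (metric (diag3 l l (- l)) 0 E21) (5 / (2 * l ^+ 2)).

(* The signs +- are powers of -1 with a boolean exponent; in the last family
   the two signs are independent. *)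
Inductive family_iii : 'M[R]_6 -> R -> Prop :=
| Family_iii_20 (b : bool) (s22 s33 : R) : s22 != 0 -> s33 != 0 ->
    family_iii (metric (S1 s22 s33) M2 ((-1) ^+ b *: E20)) 0
| Family_iii_11_1 (s22 s33 : R) : s22 != 0 -> s33 != 0 ->
    family_iii (metric (S1 s22 s33) M2 E11) 0
| Family_iii_11_2 (s22 : R) : s22 != 0 ->
    family_iii (metric (S2 s22) M2 E11) 0
| Family_iii_11_3 (s33 : R) : s33 != 0 ->
    family_iii (metric (S3 s33) M2 E11) 0
| Family_iii_10 (b c : bool) (l : R) : l != 0 ->
    family_iii (metric ((-1) ^+ b *: E10) (M1 l) ((-1) ^+ c *: E10)) 0.

(* Families (i)-(iii) do not exhaust the nilsolitons. The normal forms below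
   are also nilsolitons, and none is isometric to a member of (i)-(iii):
   - the centre <e_4,e_5,e_6> is preserved by automorphisms, so the signature
     of the block E is an invariant; -E30, -E21 and E = 0 do not occur there;
   - Omitted_11: on <e_2,e_3>, E11^-1 S has non-real eigenvalues;
   - Omitted_10 (D <> 0) and Omitted_10_flat (Ricci-flat): rank E = 1, with the
     other relative positions of the pairing M and the kernel of E. *)
Inductive omitted_family : 'M[R]_6 -> R -> Prop :=
| Omitted_30 (l : R) : l != 0 ->
    omitted_family (metric (diag3 l l l) 0 (- E30)) (5 / (2 * l ^+ 2))
| Omitted_21 (l : R) : l != 0 ->
    omitted_family (metric (diag3 l l (- l)) 0 (- E21)) (- (5 / (2 * l ^+ 2)))
| Omitted_11 (a b : R) : b != 0 ->
    omitted_family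
      (metric (mx3 [:: [:: 0; 0; 0]; [:: 0; a; b]; [:: 0; b; - a]]) M2 E11) 0
| Omitted_10 (b c : bool) (l : R) : l != 0 ->
    omitted_family
      (metric ((-1) ^+ b *: diag3 0 1 0)
         (mx3 [:: [:: 1; 0; 0]; [:: 0; 0; 0]; [:: 0; l; 0]])
         ((-1) ^+ c *: E10)) 0
| Omitted_10_flat (b c : bool) (p q r s : R) : p * s - q * r != 0 ->
    omitted_family
      (metric ((-1) ^+ b *: E10)
         (mx3 [:: [:: p; q; 0]; [:: r; s; 0]; [:: 0; 0; 0]])
         ((-1) ^+ c *: E10)) 0
| Omitted_00 (M : 'M[R]_3) : M \in unitmx ->
    omitted_family (metric 0 M 0) 0.

End CotangentHeisenberg.

(* Main.v *)
Require Import Defs.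
From mathcomp Require Import all_boot all_order all_algebra.
From mathcomp Require Import reals ring lra.

(** Write a metric as [[S, M], [M^T, E]] and its inverse as [[P, Q], [Q^T, T]]. The
    bracket is the cross product of the generator parts, with values in the centre, so
    automorphisms have diagonal blocks [B], [cofmx B] and derivations have diagonal blocks
    [X], [\tr X - X^T]. The Koszul formula gives a block triangular Ricci operator with
    diagonal blocks [- P (polar P E) / 2] and [cofmx P E / 2], where [polar] is the
    linearised cofactor, and the soliton equation collapses to [cofmx P E = - 2 gamma / 5].

    Automorphisms act on [E] through congruence, so [E] may be taken diagonal with entries
    [0], [1], [-1]. If [E] is invertible, [M] can be sheared away and the equation makes [S]
    proportional to [E^-1]. If [E] is singular, [gamma] vanishes: for rank two the equation
    says that the only surviving column of [M] is the kernel direction of [E], and what is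
    left is a pair of binary quadratic forms; for rank at most one only the pairing of
    the generators with the kernel of [E] matters. *)

Set Implicit Arguments.
Unset Strict Implicit.
Unset Printing Implicit Defensive.

Import Order.TTheory GRing.Theory Num.Theory.
Local Open Scope ring_scope.

(** * Matrices of size three *)

Lemma ord3_ind (P : 'I_3 -> Prop) :
  P (inord 0) -> P (inord 1) -> P (inord 2) -> forall i, P i.
Proof.
move=> P0 P1 P2 i; suff -> : i = inord i by case: i => [[|[|[|//]]] ?].
by rewrite inord_val.
Qed.

Lemma sum3 (V : nmodType) (F : 'I_3 -> V) :
  \sum_i F i = F (inord 0) + F (inord 1) + F (inord 2).
Proof.
rewrite !big_ord_recl big_ord0 addr0 addrA.
by congr (F _ + F _ + F _); apply/val_inj; rewrite /= inordK.
Qed.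

Section Mat33.
Variable T : comNzRingType.
Implicit Types (A : 'M[T]_3) (v : 'cV[T]_3).

Definition mat33 (a b c d e f g h i : T) : 'M[T]_3 :=
  \matrix_(k, l) (nth [::] [:: [:: a; b; c]; [:: d; e; f]; [:: g; h; i]] k)`_l.

Definition col3 (a b c : T) : 'cV[T]_3 := \col_k [:: a; b; c]`_k.

Definition dotcv n (u v : 'cV[T]_n) : T := (u^T *m v) 0 0.

Lemma dotcvC n (u v : 'cV[T]_n) : dotcv u v = dotcv v u.
Proof. by rewrite /dotcv -[u^T *m v]trmxK trmx_mul trmxK mxE. Qed.

Lemma dotcvBl n (u v w : 'cV[T]_n) : dotcv (u - v) w = dotcv u w - dotcv v w.
Proof. by rewrite /dotcv linearB mulmxBl [LHS]mxE [X in _ + X]mxE. Qed.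

Lemma dotcv_mulmxl m n (A : 'M[T]_(m, n)) (u : 'cV[T]_m) (v : 'cV[T]_n) :
  dotcv (A^T *m u) v = dotcv u (A *m v).
Proof. by rewrite /dotcv trmx_mul trmxK mulmxA. Qed.

Variant mat33_spec : 'M[T]_3 -> Type :=
  Mat33Spec a b c d e f g h i : mat33_spec (mat33 a b c d e f g h i).

Variant sym33_spec : 'M[T]_3 -> Type :=
  Sym33Spec a b c d e f : sym33_spec (mat33 a b c b d e c e f).

Variant col3_spec : 'cV[T]_3 -> Type :=
  Col3Spec a b c : col3_spec (col3 a b c).

Lemma mat33P A : mat33_spec A.
Proof.
suff -> : A = mat33 (A (inord 0) (inord 0)) (A (inord 0) (inord 1)) (A (inord 0) (inord 2))
                    (A (inord 1) (inord 0)) (A (inord 1) (inord 1)) (A (inord 1) (inord 2))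
                    (A (inord 2) (inord 0)) (A (inord 2) (inord 1)) (A (inord 2) (inord 2)).
  by [].
by apply/matrixP => k l; elim/ord3_ind: k; elim/ord3_ind: l; rewrite mxE !inordK.
Qed.

Lemma col3P v : col3_spec v.
Proof.
suff -> : v = col3 (v (inord 0) 0) (v (inord 1) 0) (v (inord 2) 0) by [].
by apply/colP => k; elim/ord3_ind: k; rewrite mxE inordK.
Qed.

Lemma mat33_inj (a b c d e f g h i a' b' c' d' e' f' g' h' i' : T) :
  mat33 a b c d e f g h i = mat33 a' b' c' d' e' f' g' h' i' ->
  [/\ [/\ a = a', b = b' & c = c'], [/\ d = d', e = e' & f = f']
    & [/\ g = g', h = h' & i = i']].
Proof.
move=> /matrixP AA'.
have entry k l : (k < 3)%N -> (l < 3)%N ->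
    (nth [::] [:: [:: a; b; c]; [:: d; e; f]; [:: g; h; i]] k)`_l =
    (nth [::] [:: [:: a'; b'; c']; [:: d'; e'; f']; [:: g'; h'; i']] k)`_l.
  by move=> k3 l3; have := AA' (Ordinal k3) (Ordinal l3); rewrite !mxE.
split; split; [exact: (entry 0 0)%N|exact: (entry 0 1)%N|exact: (entry 0 2)%N
  |exact: (entry 1 0)%N|exact: (entry 1 1)%N|exact: (entry 1 2)%N
  |exact: (entry 2 0)%N|exact: (entry 2 1)%N|exact: (entry 2 2)%N].
Qed.

Lemma col3_inj (a b c a' b' c' : T) :
  col3 a b c = col3 a' b' c' -> [/\ a = a', b = b' & c = c'].
Proof.
move=> /colP vv'; split; [move: (vv' (inord 0))|move: (vv' (inord 1))|move: (vv' (inord 2))];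
  by rewrite !mxE inordK.
Qed.

Local Ltac entrywise :=
  apply/matrixP; elim/ord3_ind; try elim/ord3_ind; move=> *;
  rewrite !mxE ?sum3 ?mxE !inordK //.

Lemma tr_mat33 (a b c d e f g h i : T) :
  (mat33 a b c d e f g h i)^T = mat33 a d g b e h c f i.
Proof. by entrywise. Qed.

Lemma add_mat33 (a b c d e f g h i a' b' c' d' e' f' g' h' i' : T) :
  mat33 a b c d e f g h i + mat33 a' b' c' d' e' f' g' h' i' =
  mat33 (a + a') (b + b') (c + c') (d + d') (e + e') (f + f') (g + g') (h + h') (i + i').
Proof. by entrywise. Qed.

Lemma opp_mat33 (a b c d e f g h i : T) :
  - mat33 a b c d e f g h i = mat33 (- a) (- b) (- c) (- d) (- e) (- f) (- g) (- h) (- i).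
Proof. by entrywise. Qed.

Lemma scale_mat33 (k a b c d e f g h i : T) :
  k *: mat33 a b c d e f g h i =
  mat33 (k * a) (k * b) (k * c) (k * d) (k * e) (k * f) (k * g) (k * h) (k * i).
Proof. by entrywise. Qed.

Lemma mul_mat33 (a b c d e f g h i a' b' c' d' e' f' g' h' i' : T) :
  mat33 a b c d e f g h i *m mat33 a' b' c' d' e' f' g' h' i' =
  mat33 (a * a' + b * d' + c * g') (a * b' + b * e' + c * h') (a * c' + b * f' + c * i')
        (d * a' + e * d' + f * g') (d * b' + e * e' + f * h') (d * c' + e * f' + f * i')
        (g * a' + h * d' + i * g') (g * b' + h * e' + i * h') (g * c' + h * f' + i * i').
Proof. by entrywise. Qed.

Lemma scalar_mat33 (a : T) : a%:M = mat33 a 0 0 0 a 0 0 0 a.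
Proof. by entrywise; rewrite -val_eqE /= !inordK. Qed.

Lemma zero_mat33 : 0 = mat33 0 0 0 0 0 0 0 0 0.
Proof. by entrywise. Qed.

Lemma trace_mat33 (a b c d e f g h i : T) : \tr (mat33 a b c d e f g h i) = a + e + i.
Proof. by rewrite /mxtrace sum3 !mxE !inordK. Qed.

Lemma det_mat33 (a b c d e f g h i : T) : \det (mat33 a b c d e f g h i) =
  a * (e * i - f * h) + b * (f * g - d * i) + c * (d * h - e * g).
Proof.
rewrite (expand_det_row _ 0) !big_ord_recl big_ord0 /cofactor.
rewrite !(expand_det_row _ 0) !big_ord_recl !big_ord0 /cofactor !det_mx11 !mxE /=.
rewrite /bump /=; ring.
Qed.

Lemma diag_mat33 (d : 'rV[T]_3) :
  diag_mx d = mat33 (d 0 (inord 0)) 0 0 0 (d 0 (inord 1)) 0 0 0 (d 0 (inord 2)).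
Proof. by entrywise; rewrite -val_eqE /= !inordK. Qed.

Lemma add_col3 (a b c a' b' c' : T) :
  col3 a b c + col3 a' b' c' = col3 (a + a') (b + b') (c + c').
Proof. by entrywise. Qed.

Lemma opp_col3 (a b c : T) : - col3 a b c = col3 (- a) (- b) (- c).
Proof. by entrywise. Qed.

Lemma zero_col3 : 0 = col3 0 0 0.
Proof. by entrywise. Qed.

Lemma mul_mat33_col3 (a b c d e f g h i x y z : T) :
  mat33 a b c d e f g h i *m col3 x y z =
  col3 (a * x + b * y + c * z) (d * x + e * y + f * z) (g * x + h * y + i * z).
Proof. by entrywise. Qed.

Lemma mul_col3_tr (a b c a' b' c' : T) : col3 a b c *m (col3 a' b' c')^T =
  mat33 (a * a') (a * b') (a * c') (b * a') (b * b') (b * c') (c * a') (c * b') (c * c').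
Proof. by entrywise; rewrite big_ord1 !mxE !inordK. Qed.

Lemma dot_col3 (a b c a' b' c' : T) :
  dotcv (col3 a b c) (col3 a' b' c') = a * a' + b * b' + c * c'.
Proof. by rewrite /dotcv !mxE sum3 !mxE !inordK. Qed.

Lemma sym33P A : A^T = A -> sym33_spec A.
Proof.
by case/mat33P: A => a b c d e f g h i; rewrite tr_mat33 => /mat33_inj[[_ -> ->] [_ _ ->] _].
Qed.

End Mat33.

Lemma dotcv_eq0 (R : realDomainType) n (u : 'cV[R]_n) : (dotcv u u == 0) = (u == 0).
Proof.
apply/eqP/eqP=> [|->]; last by rewrite /dotcv mulmx0 mxE.
rewrite /dotcv mxE => /psumr_eq0P uu; apply/colP => i; rewrite mxE.
apply/eqP; rewrite -sqrf_eq0 expr2; have := uu _ i isT; rewrite mxE => -> //.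
by move=> j _; rewrite mxE -expr2 sqr_ge0.
Qed.

Section Cofactor.
Variable T : comNzRingType.

Definition cofmx n (A : 'M[T]_n) : 'M[T]_n := (\adj A)^T.

Lemma cofmx_tr n (A : 'M[T]_n) : cofmx A^T = (cofmx A)^T.
Proof. by rewrite /cofmx -trmx_adj. Qed.

Lemma cofmx1 n : cofmx 1%:M = 1%:M :> 'M[T]_n.
Proof. by rewrite /cofmx adj1 trmx1. Qed.

Lemma cofmxZ n k (A : 'M[T]_n) : cofmx (k *: A) = k ^+ n.-1 *: cofmx A.
Proof. by rewrite /cofmx adjZ linearZ. Qed.

Lemma mul_cofmx_tr n (A : 'M[T]_n) : cofmx A *m A^T = (\det A)%:M.
Proof. by rewrite /cofmx -trmx_mul mul_mx_adj tr_scalar_mx. Qed.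

Lemma cofmx_mat33 (a b c d e f g h i : T) :
  cofmx (mat33 a b c d e f g h i) =
  mat33 (e * i - f * h) (f * g - d * i) (d * h - e * g)
        (h * c - i * b) (i * a - g * c) (g * b - h * a)
        (b * f - c * e) (c * d - a * f) (a * e - b * d).
Proof.
have cof2 k l : cofmx (mat33 a b c d e f g h i) k l =
    cofactor (mat33 a b c d e f g h i) k l by rewrite !mxE.
apply/matrixP => k l; rewrite cof2 /cofactor (expand_det_row _ 0) !big_ord_recl big_ord0.
rewrite /cofactor !det_mx11 !mxE /=.
by case: k l => [[|[|[|//]]] ?] [[|[|[|//]]] ?] /=; rewrite /bump /=; ring.
Qed.

Lemma cofmxM (A B : 'M[T]_3) : cofmx (A *m B) = cofmx A *m cofmx B.
Proof.
case/mat33P: A => *; case/mat33P: B => *.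
by rewrite mul_mat33 !cofmx_mat33 mul_mat33; congr mat33; ring.
Qed.

Lemma cofmx_cofmx (A : 'M[T]_3) : cofmx (cofmx A) = \det A *: A.
Proof.
by case/mat33P: A => *; rewrite !cofmx_mat33 det_mat33 scale_mat33; congr mat33; ring.
Qed.

Lemma cofmx_sub_rank1 (u v : 'cV[T]_3) :
  cofmx (1%:M - u *m v^T) = (1 - dotcv u v)%:M + v *m u^T.
Proof.
case/col3P: u => *; case/col3P: v => *.
rewrite !mul_col3_tr dot_col3 !scalar_mat33 opp_mat33 !add_mat33 cofmx_mat33.
by congr mat33; ring.
Qed.

Definition polar (P E : 'M[T]_3) : 'M[T]_3 := cofmx (P + E) - cofmx P - cofmx E.

(* The derivative of [P^T *m cofmx P = (\det P)%:M] in the direction [E]. *)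
Lemma polar_mul P E :
  P^T *m polar P E + E^T *m cofmx P = (\tr (E^T *m cofmx P))%:M.
Proof.
case/mat33P: P => *; case/mat33P: E => *.
rewrite /polar add_mat33 !cofmx_mat33 !opp_mat33 !add_mat33 !tr_mat33 !mul_mat33.
by rewrite trace_mat33 scalar_mat33 add_mat33; congr mat33; ring.
Qed.

End Cofactor.

Lemma cofmx_unit (T : comUnitRingType) n (A : 'M[T]_n) :
  A \in unitmx -> cofmx A \in unitmx.
Proof.
move=> uA; have : cofmx A *m A^T \in unitmx by rewrite mul_cofmx_tr unitmxE det_scalar unitrX.
by rewrite unitmx_mul => /andP[].
Qed.

Section CrossProduct.
Variable T : comNzRingType.
Implicit Types (A B P E : 'M[T]_3) (u v w : 'cV[T]_3).

(* Locked so that rewriting with products of [mat33] does not unfold it. *)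
Definition crossmx u : 'M[T]_3 :=
  let x k := u (inord k) 0 in
  locked (mat33 0 (- x 2) (x 1) (x 2) 0 (- x 0) (- x 1) (x 0) 0).

Lemma crossmx_col3 (a b c : T) : crossmx (col3 a b c) = mat33 0 (- c) b c 0 (- a) (- b) a 0.
Proof. by rewrite /crossmx -lock !mxE !inordK. Qed.

Lemma tr_crossmx u : (crossmx u)^T = - crossmx u.
Proof.
by case/col3P: u => *; rewrite crossmx_col3 tr_mat33 opp_mat33; congr mat33; ring.
Qed.

Lemma crossmxC u v : crossmx u *m v = - (crossmx v *m u).
Proof.
case/col3P: u => *; case/col3P: v => *.
by rewrite !crossmx_col3 !mul_mat33_col3 opp_col3; congr col3; ring.
Qed.

Lemma dotcv_crossmx u v w : dotcv (crossmx u *m v) w = dotcv (crossmx v *m w) u.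
Proof.
case/col3P: u => *; case/col3P: v => *; case/col3P: w => *.
by rewrite !crossmx_col3 !mul_mat33_col3 !dot_col3; ring.
Qed.

Lemma tr_crossmxM u v : \tr (crossmx u *m crossmx v) = - 2 * dotcv u v.
Proof.
case/col3P: u => *; case/col3P: v => *.
by rewrite !crossmx_col3 mul_mat33 trace_mat33 dot_col3; ring.
Qed.

Lemma tr_crossmx_sym u P : P^T = P -> \tr (crossmx u *m P) = 0.
Proof.
case/sym33P=> *; case/col3P: u => *.
by rewrite crossmx_col3 mul_mat33 trace_mat33; ring.
Qed.

Lemma crossmx_cofmx A u : A *m crossmx u *m A^T = crossmx (cofmx A *m u).
Proof.
case/mat33P: A => *; case/col3P: u => *.
rewrite cofmx_mat33 mul_mat33_col3 !crossmx_col3 tr_mat33 !mul_mat33.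
by congr mat33; ring.
Qed.

Lemma tr_crossmx_cofmx P u v : P^T = P ->
  \tr (crossmx u *m P *m crossmx v *m P) = - 2 * dotcv u (cofmx P *m v).
Proof.
by move=> PT; rewrite -tr_crossmxM -crossmx_cofmx PT !mulmxA.
Qed.

Lemma tr_crossmx_polar P E u v : P^T = P -> E^T = E ->
  \tr (crossmx u *m E *m crossmx v *m P) = - dotcv u (polar P E *m v).
Proof.
case/sym33P=> ? ? ? ? ? ?; case/sym33P=> *; case/col3P: u => *; case/col3P: v => *.
rewrite /polar add_mat33 !crossmx_col3 !cofmx_mat33 !opp_mat33 !add_mat33 !mul_mat33.
by rewrite mul_mat33_col3 dot_col3 trace_mat33; ring.
Qed.

Lemma mulmx_crossmx A u v : crossmx (A *m u) *m (A *m v) = cofmx A *m (crossmx u *m v).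
Proof.
case/mat33P: A => *; case/col3P: u => *; case/col3P: v => *.
by rewrite cofmx_mat33 !mul_mat33_col3 !crossmx_col3 !mul_mat33_col3; congr col3; ring.
Qed.

Lemma crossmx_deriv A u v : crossmx (A *m u) *m v + crossmx u *m (A *m v) =
  ((\tr A)%:M - A^T) *m (crossmx u *m v).
Proof.
case/mat33P: A => *; case/col3P: u => *; case/col3P: v => *.
rewrite trace_mat33 scalar_mat33 tr_mat33 opp_mat33 add_mat33 !mul_mat33_col3 !crossmx_col3.
by rewrite !mul_mat33_col3 add_col3; congr col3; ring.
Qed.

Lemma crossmx_ext m (A B : 'M[T]_(m, 3)) :
  (forall u v, A *m (crossmx u *m v) = B *m (crossmx u *m v)) -> A = B.
Proof.
move=> AB; have cross_basis k : exists u v, crossmx u *m v = delta_mx k 0.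
  have basisE : delta_mx k 0 =
      col3 (T := T) (k == inord 0)%:R (k == inord 1)%:R (k == inord 2)%:R.
    by apply/matrixP; elim/ord3_ind => j; rewrite ord1 !mxE !inordK // eqxx andbT eq_sym.
  rewrite basisE; elim/ord3_ind: k {basisE};
    rewrite -!val_eqE /= !inordK //=;
    [exists (col3 0 1 0), (col3 0 0 1)|exists (col3 0 0 1), (col3 1 0 0)
    |exists (col3 1 0 0), (col3 0 1 0)];
    by rewrite crossmx_col3 mul_mat33_col3; congr col3; ring.
apply/trmx_inj/row_matrixP => k; rewrite -!tr_col !colE.
by have [u [v <-]] := cross_basis k; rewrite AB.
Qed.

End CrossProduct.

(** * The Lie algebra in block form *)

Local Notation mul_block_col33 := (@mul_block_col _ 3 3 3 3).
Local Notation mulmx_block33 := (@mulmx_block _ 3 3 3 3 3 3).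
Local Notation tr_block33 := (@tr_block_mx _ 3 3 3 3).
Local Notation eq_block33 := (@eq_block_mx _ 3 3 3 3).

Section LieAlgebra.
Variable R : realType.
Implicit Types (B C K X Y Z : 'M[R]_3) (u v w : 'cV[R]_3).

Lemma bracket_col_mx u u' v v' :
  bracket (col_mx u v : 'cV[R]_6) (col_mx u' v' : 'cV_6) =
  col_mx (0 : 'cV_3) (crossmx u *m u').
Proof.
have coordE w w' k : (k < 3)%N -> Defs.coord (col_mx w w' : 'cV[R]_6) k.+1 = w (inord k) 0.
  move=> k3; have -> : w (inord k) 0 = col_mx w w' (lshift 3 (inord k)) 0 by rewrite col_mxEu.
  by congr (col_mx w w' _ 0); apply/val_inj; rewrite /= !inordK // (leq_trans k3).
have eE k : (k < 3)%N -> Defs.e R k.+4 = col_mx (0 : 'cV_3) (delta_mx (inord k) 0).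
  move=> k3; rewrite -(@delta_mx_dshift _ 3 3); congr (delta_mx _ 0).
  by apply/val_inj; rewrite /= !inordK // !addSn ltnS.
rewrite /bracket !coordE // !eE // !(@scale_col_mx _ 3 3) !scaler0.
rewrite (@opp_col_mx _ 3 3) !(@add_col_mx _ 3 3) oppr0 !addr0; congr (@col_mx _ 3 3 _ _ _).
case/col3P: u => *; case/col3P: u' => *; rewrite crossmx_col3 mul_mat33_col3.
by apply/colP; elim/ord3_ind; rewrite !mxE -!val_eqE /= !inordK //=; ring.
Qed.

Lemma derivation_block X Z Y K : derivation (block_mx X Z Y K : 'M[R]_6) <->
  Z = 0 /\ K = (\tr X)%:M - X^T.
Proof.
split=> [dD|[-> ->] x y].
  have D_cross u u' : Z *m (crossmx u *m u') = 0 /\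
      K *m (crossmx u *m u') = ((\tr X)%:M - X^T) *m (crossmx u *m u').
    have := dD (col_mx u (0 : 'cV_3)) (col_mx u' (0 : 'cV_3)).
    rewrite bracket_col_mx !mul_block_col33 !bracket_col_mx !mulmx0 !addr0 !add0r.
    rewrite (@add_col_mx _ 3 3) addr0 crossmx_deriv.
    by move=> /(@eq_col_mx _ 3 3).
  split; apply: crossmx_ext => u v; last exact: (D_cross u v).2.
  by rewrite mul0mx; exact: (D_cross u v).1.
rewrite -(vsubmxK (x : 'cV_(3 + 3))) -(vsubmxK (y : 'cV_(3 + 3))).
rewrite bracket_col_mx !mul_block_col33 !bracket_col_mx !mulmx0 !mul0mx !addr0 add0r.
by rewrite (@add_col_mx _ 3 3) addr0 crossmx_deriv.
Qed.

Lemma automorphism_block B Z C K : automorphism (block_mx B Z C K : 'M[R]_6) <->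
  [/\ B \in unitmx, Z = 0 & K = cofmx B].
Proof.
split=> [[uA hA]|[uB -> ->]].
  have A_cross u u' : Z *m (crossmx u *m u') = 0 /\
      K *m (crossmx u *m u') = cofmx B *m (crossmx u *m u').
    have := hA (col_mx u (0 : 'cV_3)) (col_mx u' (0 : 'cV_3)).
    rewrite bracket_col_mx !mul_block_col33 !bracket_col_mx !mulmx0 !addr0 !add0r.
    by rewrite mulmx_crossmx => /(@eq_col_mx _ 3 3).
  have Z0 : Z = 0.
    by apply: crossmx_ext => u v; rewrite mul0mx; exact: (A_cross u v).1.
  split=> //; last by apply: crossmx_ext => u v; exact: (A_cross u v).2.
  by move: uA; rewrite Z0 !unitmxE (@det_lblock _ 3 3) unitrM => /andP[].
split=> [|x y].
  by rewrite unitmxE (@det_lblock _ 3 3) unitrM -!unitmxE uB cofmx_unit.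
rewrite -(vsubmxK (x : 'cV_(3 + 3))) -(vsubmxK (y : 'cV_(3 + 3))).
rewrite bracket_col_mx !mul_block_col33 !bracket_col_mx !mulmx0 !mul0mx !addr0 add0r.
by rewrite mulmx_crossmx.
Qed.

End LieAlgebra.

(** * The Ricci operator *)

Section Sandwich.
Variable T : comNzRingType.

Lemma mxtrace_sandwich m n k (X : 'M[T]_(m, n)) (A : 'M_(n, k)) (Y : 'M_(k, m)) :
  \tr (X *m A *m Y) = \tr (A *m (Y *m X)).
Proof. by rewrite mxtrace_mulC (mulmxA Y) (mxtrace_mulC (Y *m X)). Qed.

Lemma mul_sandwich m n k l n' k' m' (X : 'M[T]_(m, n)) (A : 'M_(n, k)) (Y : 'M_(k, l))
    (X' : 'M_(l, n')) (A' : 'M_(n', k')) (Y' : 'M_(k', m')) :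
  (X *m A *m Y) *m (X' *m A' *m Y') = X *m (A *m (Y *m X') *m A') *m Y'.
Proof. by rewrite !mulmxA. Qed.

End Sandwich.

(* [U] projects onto the generators, [W] embeds the centre, [N x] is the restriction of
   [g(x, -)] to the centre and [L] consists of the first three columns of [g^-1]. *)
Section RicciOperator.
Variable R : realType.
Variables (g : 'M[R]_6) (U N : 'M[R]_(3, 6)) (W L : 'M[R]_(6, 3)) (P E : 'M[R]_3).
Hypotheses (gT : g^T = g) (gu : g \in unitmx).
Hypothesis bracketE : forall x y, bracket x y = W *m (crossmx (U *m x) *m (U *m y)).
Hypotheses (UW : U *m W = 0) (gW : g *m W = N^T) (gL : g *m L = U^T).
Hypotheses (UL : U *m L = P) (NW : N *m W = E).
Implicit Types (x y z : 'cV[R]_6).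

Let WgE : W^T *m g = N.
Proof. by rewrite -gT -trmx_mul gW trmxK. Qed.

Let NL : N *m L = 0.
Proof. by rewrite -WgE -mulmxA gL -trmx_mul UW trmx0. Qed.

Let PT : P^T = P.
Proof. by rewrite -UL -[U]trmxK -gL !trmx_mul !trmxK gT mulmxA. Qed.

Let ET : E^T = E.
Proof. by rewrite -NW -WgE !trmx_mul !trmxK gT mulmxA. Qed.

Definition connection x : 'M[R]_6 :=
  2^-1 *: (W *m crossmx (U *m x) *m U
           - L *m (crossmx (N *m x) *m U - crossmx (U *m x) *m N)).

Definition connection_swap y : 'M[R]_6 :=
  2^-1 *: (L *m (crossmx (U *m y) *m N - crossmx (N *m y) *m U)
           - W *m crossmx (U *m y) *m U).

Lemma inner_bracket x y z :
  inner g (bracket x y) z = dotcv (crossmx (U *m x) *m (U *m y)) (N *m z).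
Proof. by rewrite /inner /dotcv bracketE trmx_mul -WgE -!mulmxA. Qed.

Lemma koszulE x y z : koszul g x y z =
  dotcv (N^T *m (crossmx (U *m x) *m (U *m y))
         - U^T *m (crossmx (N *m x) *m (U *m y) - crossmx (U *m x) *m (N *m y))) z.
Proof.
rewrite /koszul !inner_bracket -[dotcv _ (N *m x)]dotcv_crossmx [dotcv _ (N *m y)]dotcv_crossmx.
by rewrite !dotcvBl !dotcv_mulmxl dotcvBl opprB addrA addrAC.
Qed.

Lemma nablaE x y : nabla g x y = connection x *m y.
Proof.
rewrite /nabla /connection.
set V := N^T *m (crossmx (U *m x) *m (U *m y))
    - U^T *m (crossmx (N *m x) *m (U *m y) - crossmx (U *m x) *m (N *m y)).
have -> : \col_k (koszul g x y (delta_mx k 0) / 2) = 2^-1 *: V.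
  by apply/colP => k; rewrite 2!mxE koszulE -/V mulrC /dotcv -colE !mxE.
rewrite -scalemxAr -scalemxAl; congr (_ *: _).
by rewrite /V -gW -gL -!mulmxA -mulmxBr mulKmx // !mulmxBl -!mulmxA mulmxBl -!mulmxA.
Qed.

Lemma connection_swapE x y : connection x *m y = connection_swap y *m x.
Proof.
rewrite /connection /connection_swap -!scalemxAl; congr (_ *: _).
rewrite !mulmxBl -!mulmxA !mulmxBl -!mulmxA.
rewrite [crossmx (U *m x) *m (U *m y)]crossmxC [crossmx (N *m x) *m (U *m y)]crossmxC.
rewrite [crossmx (U *m x) *m (N *m y)]crossmxC mulmxN opprK.
by rewrite ?mulmxDr ?mulmxBr ?mulmxN opprD opprK addrC.
Qed.

Lemma tr_connection_swap y : \tr (connection_swap y) = 0.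
Proof.
rewrite /connection_swap linearZ linearB mulmxBr linearB /= !mulmxA.
rewrite !(mxtrace_sandwich L, mxtrace_sandwich W).
by rewrite UW NL UL !mulmx0 linear0 tr_crossmx_sym // !subr0 mulr0.
Qed.

Lemma tr_connectionM x y : \tr (connection x *m connection_swap y) =
  4^-1 * \tr (crossmx (N *m x) *m P *m crossmx (N *m y) *m P).
Proof.
rewrite /connection /connection_swap.
set a := crossmx (U *m x); set b := crossmx (U *m y).
set na := crossmx (N *m x); set nb := crossmx (N *m y).
rewrite -scalemxAl -scalemxAr !linearZ /= mulrA.
have -> : 2^-1 * 2^-1 = 4^-1 :> R by field.
congr (_ * _).
have PE : \tr (a *m E *m b *m P) = \tr (a *m P *m b *m E).
  rewrite -mxtrace_tr !trmx_mul PT ET /b /a !tr_crossmx.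
  rewrite !(mulNmx, mulmxN) opprK.
  by rewrite -!mulmxA mxtrace_mulC -!mulmxA mxtrace_mulC -!mulmxA mxtrace_mulC !mulmxA.
rewrite !(mulmxBr L) !(mulmxA L) !mulmxBl !mulmxBr !raddfB /=.
rewrite !mul_sandwich !(mxtrace_sandwich W) !(mxtrace_sandwich L).
by rewrite !(UW, NL, UL, NW, mulmx0, mul0mx, mxtrace0) PE; ring.
Qed.

Lemma tr_connection_bracket x y :
  \tr (connection_swap y *m (W *m crossmx (U *m x) *m U)) =
  2^-1 * \tr (crossmx (U *m y) *m E *m crossmx (U *m x) *m P).
Proof.
rewrite /connection_swap -scalemxAl linearZ /=; congr (_ * _).
rewrite mulmxBr !mulmxBl !(mulmxA L) !mul_sandwich !raddfB /=.
rewrite !(mxtrace_sandwich L, mxtrace_sandwich W).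
by rewrite !(UW, NW, UL, mulmx0, mul0mx, mxtrace0); ring.
Qed.

Lemma ricci_tensor_trace x y : ricci_tensor g x y =
  \tr (connection_swap (connection x *m y) - connection x *m connection_swap y
       + connection_swap y *m (W *m crossmx (U *m x) *m U)).
Proof.
apply: eq_bigr => k _; rewrite /curvature !nablaE.
have entryE (A : 'M[R]_6) : A k k = (A *m (delta_mx k 0 : 'cV_6)) k 0 by rewrite -colE mxE.
rewrite entryE; congr (fun_of_matrix _ k 0); move: (delta_mx k 0) => z.
move: connection connection_swap connection_swapE => nab swap swapE.
rewrite (swapE z (nab x *m y)) (swapE z y) (swapE (bracket z x) y) mulmxDl mulmxBl mulmxA.
by rewrite bracketE crossmxC !mulmxN opprK !mulmxA.
Qed.

Lemma ricci_tensorE x y : ricci_tensor g x y =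
  2^-1 * (dotcv (N *m y) (cofmx P *m (N *m x)) - dotcv (U *m y) (polar P E *m (U *m x))).
Proof.
rewrite ricci_tensor_trace linearD linearB /= tr_connection_swap sub0r.
rewrite tr_connectionM tr_connection_bracket -mulmxA mxtrace_mulC mulmxA.
by rewrite tr_crossmx_cofmx // tr_crossmx_polar //; field.
Qed.

Lemma ricci_operatorE :
  ricci_operator g = 2^-1 *: (W *m cofmx P *m N - L *m polar P E *m U).
Proof.
have formE (A : 'M[R]_3) (F : 'M[R]_(3, 6)) i j :
    dotcv (F *m (delta_mx i 0 : 'cV_6)) (A *m (F *m (delta_mx j 0 : 'cV_6))) =
    (F^T *m A *m F) i j.
  transitivity (((delta_mx i 0 : 'cV_6)^T *m (F^T *m A *m F)
                 *m (delta_mx j 0 : 'cV_6)) 0 0); first by rewrite /dotcv trmx_mul !mulmxA.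
  by move: (F^T *m A *m F) => B; rewrite trmx_delta -rowE -colE !mxE.
rewrite /ricci_operator.
have -> : \matrix_(i, j) ricci_tensor g (delta_mx j 0) (delta_mx i 0) =
    2^-1 *: (N^T *m cofmx P *m N - U^T *m polar P E *m U).
  apply/matrixP => i j; rewrite mxE ricci_tensorE !formE.
  by rewrite [RHS]mxE [X in _ = _ * X]mxE [X in _ = _ * (_ + X)]mxE.
by rewrite -gW -gL -scalemxAr -!mulmxA -mulmxBr mulKmx.
Qed.

End RicciOperator.

(** * The soliton equation *)

Section SolitonEquation.
Variable R : realType.
Implicit Types S M E P Q T : 'M[R]_3.

Lemma metric_eta (g : 'M[R]_(3 + 3)) :
  g^T = g -> g = metric (ulsubmx g) (ursubmx g) (drsubmx g).
Proof. by move=> gT; rewrite /metric trmx_ursub gT submxK. Qed.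

Lemma metric_mul_eq1 S M E P Q T : metric S M E *m metric P Q T = 1%:M <->
  [/\ S *m P + M *m Q^T = 1%:M, S *m Q + M *m T = 0,
      M^T *m P + E *m Q^T = 0 & M^T *m Q + E *m T = 1%:M].
Proof.
have one6 : (1%:M : 'M[R]_6) = block_mx (1%:M : 'M_3) (0 : 'M_3) (0 : 'M_3) 1%:M.
  by rewrite -(@scalar_mx_block _ 3 3).
rewrite /metric mulmx_block33 one6.
by split=> [/eq_block33|[-> -> -> ->]].
Qed.

Lemma is_metricP S M E : is_metric (metric S M E) <->
  [/\ S^T = S, E^T = E
    & exists P Q T, P^T = P /\ metric S M E *m metric P Q T = 1%:M].
Proof.
split=> [[gT gu]|[ST ET [P [Q [T [_ ginv]]]]]]; last first.
  by split; [rewrite /metric tr_block33 trmxK ST ET|exact: (mulmx1_unit ginv).1].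
have [ST _ _ ET] := eq_block33 (etrans (esym (tr_block33 _ _ _ _)) gT).
split=> //; pose h : 'M[R]_(3 + 3) := invmx (metric S M E).
have hT : h^T = h by rewrite /h trmx_inv gT.
exists (ulsubmx h), (ursubmx h), (drsubmx h).
by rewrite -metric_eta // trmx_ulsub hT; split=> //; exact: mulmxV.
Qed.

Lemma ricci_operator_metric S M E P Q T : S^T = S -> E^T = E ->
  metric S M E *m metric P Q T = 1%:M ->
  ricci_operator (metric S M E) =
  block_mx (- (2^-1 *: (P *m polar P E))) 0
           (2^-1 *: (cofmx P *m M^T - Q^T *m polar P E)) (2^-1 *: (cofmx P *m E)).
Proof.
move=> ST ET ginv; have [SP _ MP _] := (metric_mul_eq1 _ _ _ _ _ _).1 ginv.
pose U : 'M[R]_(3, 6) := row_mx 1%:M (0 : 'M_3).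
pose W : 'M[R]_(6, 3) := col_mx (0 : 'M_3) 1%:M.
rewrite (@ricci_operatorE _ _ U (row_mx M^T E) W (col_mx P Q^T) P E).
- rewrite [_ *m cofmx P](@mul_col_mx _ 3 3) [_ *m polar P E](@mul_col_mx _ 3 3).
  rewrite mul0mx mul1mx !(@mul_col_row _ 3 3 _ 3 3) !mul0mx !mulmx1 !mulmx0.
  rewrite (@opp_block_mx _ 3 3 3 3) (@add_block_mx _ 3 3 3 3) (@scale_block_mx _ 3 3 3 3).
  by rewrite sub0r !oppr0 !addr0 scaler0 scalerN.
- by rewrite /metric tr_block33 trmxK ST ET.
- exact: (mulmx1_unit ginv).1.
- have genE (x : 'cV[R]_(3 + 3)) : U *m x = usubmx x.
    by rewrite -{1}(vsubmxK x) (@mul_row_col _ _ 3 3) mul1mx mul0mx addr0.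
  move=> x y; rewrite !genE (@mul_col_mx _ 3 3) mul0mx mul1mx.
  rewrite -(bracket_col_mx _ _ (dsubmx (x : 'cV_(3 + 3))) (dsubmx (y : 'cV_(3 + 3)))).
  by rewrite !vsubmxK.
- by rewrite (@mul_row_col _ _ 3 3) mul0mx mulmx0 addr0.
- by rewrite mul_block_col33 (@tr_row_mx _ 3 3 3) trmxK ET !mulmx0 !add0r !mulmx1.
- by rewrite mul_block_col33 (@tr_row_mx _ 3 3 3) trmx1 trmx0 SP MP.
- by rewrite (@mul_row_col _ _ 3 3) mul1mx mul0mx addr0.
- by rewrite (@mul_row_col _ _ 3 3) mulmx0 mulmx1 add0r.
Qed.

(* Since [P *m polar P E = (\tr Y)%:M - Y^T], the condition on the diagonal blocks of the
   Ricci operator is a linear equation for [Y]. *)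
Lemma derivation_ricci_operator S M E P Q T (gamma : R) : S^T = S -> E^T = E -> P^T = P ->
  metric S M E *m metric P Q T = 1%:M ->
  let Y := cofmx P *m E in
  derivation (ricci_operator (metric S M E) - gamma%:M) <-> Y = (- (\tr Y / 2 + gamma))%:M.
Proof.
move=> ST ET PT ginv Y; set t := \tr Y.
have polE : P *m polar P E = t%:M - Y^T.
  have := polar_mul P E; have -> : E^T *m cofmx P = Y^T by rewrite trmx_mul -cofmx_tr PT.
  by rewrite PT mxtrace_tr => <-; rewrite addrK.
rewrite (ricci_operator_metric ST ET ginv) polE -/Y.
rewrite (@scalar_mx_block _ 3 3) (@opp_block_mx _ 3 3 3 3) (@add_block_mx _ 3 3 3 3).
rewrite derivation_block oppr0 addr0; set X := - _ - _.
have trX : \tr X = - t - 3 * gamma.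
  by rewrite /X raddfB raddfN /= mxtraceZ raddfB /= !mxtrace_scalar mxtrace_tr -/t; field.
rewrite {}trX; split=> [[_]|YE]; last split=> //.
- move=> /matrixP YE; apply/matrixP => i j; move: (YE i j); rewrite !mxE eq_sym.
  by case: (i == j); rewrite ?mulr1n ?mulr0n; lra.
- apply/matrixP => i j; have := congr1 (fun A : 'M_3 => A i j) YE; rewrite !mxE eq_sym.
  by case: (j == i); rewrite ?mulr1n ?mulr0n; lra.
Qed.

Lemma nilsolitonP S M E P Q T (gamma : R) : S^T = S -> E^T = E -> P^T = P ->
  metric S M E *m metric P Q T = 1%:M ->
  nilsoliton (metric S M E) gamma <-> cofmx P *m E = (- (2 * gamma / 5))%:M.
Proof.
move=> ST ET PT ginv; set Y := cofmx P *m E; set g := metric S M E.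
have derE := derivation_ricci_operator gamma ST ET PT ginv.
have gm : is_metric g by apply/is_metricP; split=> //; exists P, Q, T.
split=> [[_ [D dD RicE]]|YE].
  have /derE : derivation (ricci_operator g - gamma%:M) by rewrite RicE addrC addKr.
  rewrite -/Y => YE; have := congr1 (@mxtrace R 3) YE.
  by rewrite {3}YE mxtrace_scalar => trY; congr (_%:M); lra.
split=> //; exists (ricci_operator g - gamma%:M); last by rewrite addrC subrK.
by apply/derE; rewrite -/Y YE mxtrace_scalar; congr (_%:M); lra.
Qed.

Lemma nilsoliton_metricP S M E gamma : nilsoliton (metric S M E) gamma <->
  [/\ S^T = S, E^T = E & exists P Q T,
    [/\ P^T = P, metric S M E *m metric P Q T = 1%:M
      & cofmx P *m E = (- (2 * gamma / 5))%:M]].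
Proof.
split=> [nil|[ST ET [P [Q [T [PT ginv cE]]]]]].
  have [ST ET [P [Q [T [PT ginv]]]]] := (is_metricP _ _ _).1 nil.1.
  split=> //; exists P, Q, T; split=> //.
  exact: (nilsolitonP _ ST ET PT ginv).1 nil.
exact: (nilsolitonP _ ST ET PT ginv).2 cE.
Qed.

Lemma nilsoliton_uniq (g : 'M[R]_6) gamma gamma' :
  nilsoliton g gamma -> nilsoliton g gamma' -> gamma = gamma'.
Proof.
move=> nil nil'; have [[gT _] _] := nil; move: nil nil'; rewrite (metric_eta gT).
move=> /nilsoliton_metricP[ST ET [P [Q [T [PT ginv cE]]]]].
move=> /(nilsolitonP _ ST ET PT ginv); rewrite cE => /matrixP/(_ 0 0).
by rewrite !mxE /=; lra.
Qed.

Lemma nilsoliton_singular S M E gamma :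
  \det E = 0 -> nilsoliton (metric S M E) gamma -> gamma = 0.
Proof.
move=> dE /nilsoliton_metricP[_ _ [P [_ [_ [_ _ /(congr1 determinant)]]]]].
rewrite det_mulmx dE mulr0 det_scalar => /esym/eqP; rewrite expf_eq0 /= => /eqP; lra.
Qed.

Lemma nilsoliton_ker S M E gamma (u v : 'cV[R]_3) : nilsoliton (metric S M E) gamma ->
  S *m u + M *m v = 0 -> M^T *m u + E *m v = 0 -> u = 0 /\ v = 0.
Proof.
move=> [[_ gu] _] Suv Euv.
have : metric S M E *m (col_mx u v : 'cV[R]_6) = 0.
  by rewrite mul_block_col33 Suv Euv col_mx0.
move=> /(congr1 (mulmx (invmx (metric S M E)))); rewrite mulKmx // mulmx0.
by rewrite -[0](@col_mx0 _ 3 3 1) => /(@eq_col_mx _ 3 3).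
Qed.

End SolitonEquation.

(** * Isometries *)

Section Isometries.
Variable R : realType.
Implicit Types (g h : 'M[R]_6) (S M E P Q T B C K L : 'M[R]_3).

Lemma isometric_refl g : isometric g g.
Proof.
exists 1%:M; last by rewrite trmx1 mul1mx mulmx1.
by split=> [|x y]; rewrite ?unitmx1 ?mul1mx.
Qed.

Lemma automorphism_inv (A : 'M[R]_6) : automorphism A -> automorphism (invmx A).
Proof.
move=> [uA hA]; split=> [|x y]; first by rewrite unitmx_inv.
by rewrite -[RHS](mulKmx uA) hA !mulKVmx.
Qed.

Lemma isometric_sym g h : isometric g h -> isometric h g.
Proof.
move=> [A aA ->]; have [uA _] := aA; exists (invmx A); first exact: automorphism_inv.
by rewrite trmx_inv !mulmxA mulVmx ?unitmx_tr // mul1mx mulmxK.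
Qed.

Lemma isometric_trans g h k : isometric g h -> isometric h k -> isometric g k.
Proof.
move=> [A [uA hA] ->] [B [uB hB] ->]; exists (B *m A).
  by split=> [|x y]; rewrite ?unitmx_mul ?uA ?uB // -!mulmxA hA hB.
by rewrite trmx_mul !mulmxA.
Qed.

Lemma automorphismP (A : 'M[R]_6) : automorphism A ->
  exists B C, B \in unitmx /\ A = block_mx B 0 C (cofmx B).
Proof.
rewrite -{1}(submxK (A : 'M_(3 + 3))) => /automorphism_block[uB Z0 KE].
exists (ulsubmx (A : 'M_(3 + 3))), (dlsubmx (A : 'M_(3 + 3))); split=> //.
by rewrite -[LHS](submxK (A : 'M_(3 + 3))) Z0 KE.
Qed.

Lemma metric_pullback S M E B C : E^T = E ->
  (block_mx B 0 C (cofmx B) : 'M[R]_6)^T *m metric S M E *m block_mx B 0 C (cofmx B) =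
  metric (B^T *m S *m B + B^T *m M *m C + C^T *m M^T *m B + C^T *m E *m C)
         ((B^T *m M + C^T *m E) *m cofmx B) ((cofmx B)^T *m E *m cofmx B).
Proof.
move=> ET; rewrite /metric tr_block33 trmx0 !mulmx_block33.
rewrite !(mul0mx, mulmx0, add0r, addr0); congr (@block_mx _ 3 3 3 3 _ _ _ _).
- by rewrite !mulmxDl !addrA [X in _ = X + _]addrAC.
- by rewrite trmx_mul linearD /= !trmx_mul !trmxK ET mulmxDr !mulmxA.
Qed.

Lemma metric_pushforward P Q T B C K : P^T = P ->
  (block_mx B 0 C K : 'M[R]_6) *m metric P Q T *m (block_mx B 0 C K : 'M[R]_6)^T =
  metric (B *m P *m B^T) (B *m P *m C^T + B *m Q *m K^T)
         ((C *m P + K *m Q^T) *m C^T + (C *m Q + K *m T) *m K^T).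
Proof.
move=> PT; rewrite /metric tr_block33 trmx0 !mulmx_block33.
rewrite !(mul0mx, mulmx0, add0r, addr0); congr (@block_mx _ 3 3 3 3 _ _ _ _).
by rewrite linearD /= !trmx_mul !trmxK PT mulmxDl !mulmxA.
Qed.

Lemma isometric_block B C S M E S' M' E' : E^T = E -> B \in unitmx ->
  S' = B^T *m S *m B + B^T *m M *m C + C^T *m M^T *m B + C^T *m E *m C ->
  M' = (B^T *m M + C^T *m E) *m cofmx B ->
  E' = (cofmx B)^T *m E *m cofmx B ->
  isometric (metric S M E) (metric S' M' E').
Proof.
move=> ET uB -> -> ->; rewrite -metric_pullback //; apply: isometric_sym.
by exists (block_mx B 0 C (cofmx B)) => //; apply/automorphism_block.
Qed.

Lemma isometric_nilsoliton g h gamma :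
  isometric g h -> nilsoliton g gamma -> nilsoliton h gamma.
Proof.
move=> /isometric_sym[A aA ->] nil; have [[gT _] _] := nil; rewrite (metric_eta gT) in nil *.
have [ST ET [P [Q [T [PT ginv cE]]]]] := (nilsoliton_metricP _ _ _ _).1 nil.
move: ginv cE; set S := ulsubmx _; set M := ursubmx _; set E := drsubmx _ => ginv cE.
have [uA _] := aA; have [B [C [uB AE]]] := automorphismP aA.
have [B' [C' [_ AE']]] := automorphismP (automorphism_inv aA).
have BB' : B *m B' = 1%:M.
  have := mulmxV uA; rewrite AE' {1}AE mulmx_block33 (@scalar_mx_block _ 3 3).
  by move=> /eq_block33[]; rewrite mul0mx addr0.
pose h' := invmx A *m metric P Q T *m (invmx A)^T.
have hinv : A^T *m metric S M E *m A *m h' = 1%:M.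
  rewrite /h' !mulmxA mulmxK // -(mulmxA A^T) ginv mulmx1.
  by rewrite -trmx_mul mulVmx // trmx1.
rewrite /h' AE' AE metric_pushforward // metric_pullback // in hinv *.
apply/(nilsolitonP _ _ _ _ hinv).
- by rewrite !linearD /= !trmx_mul !trmxK ST ET !mulmxA [X in X + _ = _]addrAC.
- by rewrite !trmx_mul trmxK ET mulmxA.
- by rewrite !trmx_mul trmxK PT mulmxA.
rewrite !cofmxM cofmx_tr -!mulmxA (mulmxA (cofmx B')^T) -trmx_mul -cofmxM BB'.
rewrite cofmx1 trmx1 mul1mx (mulmxA (cofmx P)) cE mul_scalar_mx -scalemxAr -cofmxM.
by rewrite (mulmx1C BB') cofmx1 scalemx1.
Qed.

(* Completing the square: [L] plays the role of a partial inverse of [M]. *)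
Lemma isometric_project S M E L : S^T = S -> E^T = E -> E *m L = 0 ->
  isometric (metric S M E) (metric ((1%:M - M *m L) *m S *m (1%:M - M *m L)^T) M E).
Proof.
move=> ST ET EL; set H := M *m L.
pose C := L *m (2^-1 *: (S *m H^T) - S).
have EC : E *m C = 0 by rewrite /C mulmxA EL mul0mx.
have CE : C^T *m E = 0 by rewrite -[E]ET -trmx_mul EC trmx0.
have MC : M *m C = 2^-1 *: (H *m S *m H^T) - H *m S.
  by rewrite /C mulmxA mulmxBr -scalemxAr !mulmxA.
clearbody C H; apply: (isometric_block (B := 1%:M) (C := C)) => //; first exact: unitmx1.
- rewrite !trmx1 !mul1mx !mulmx1 CE mul0mx addr0 -trmx_mul MC.
  have -> : (2^-1 *: (H *m S *m H^T) - H *m S)^T = 2^-1 *: (H *m S *m H^T) - S *m H^T.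
    by rewrite linearB linearZ /= !trmx_mul ST trmxK mulmxA.
  rewrite linearB /= trmx1 mulmxBr mulmx1 !mulmxBl !mul1mx.
  move: (H *m S *m H^T) (H *m S) (S *m H^T) => HSH HS SH.
  by apply/matrixP => i j; rewrite !mxE; field.
- by rewrite trmx1 mul1mx CE addr0 cofmx1 mulmx1.
- by rewrite cofmx1 trmx1 mul1mx mulmx1.
Qed.

Lemma isometric_project_line S M E L (u : 'cV[R]_3) : S^T = S -> E^T = E -> E *m L = 0 ->
  1%:M - M *m L = u *m u^T ->
  isometric (metric S M E) (metric (dotcv u (S *m u) *: (u *m u^T)) M E).
Proof.
move=> ST ET EL uuE; have := isometric_project M ST ET EL; rewrite uuE.
suff -> : u *m u^T *m S *m (u *m u^T)^T = dotcv u (S *m u) *: (u *m u^T) by [].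
rewrite trmx_mul trmxK -!mulmxA (mulmxA S) (mulmxA u^T) [u^T *m _]mx11_scalar mul_scalar_mx.
by rewrite -scalemxAr.
Qed.

Lemma nilsoliton_project_line S M E L (u : 'cV[R]_3) gamma :
  nilsoliton (metric S M E) gamma -> E *m L = 0 -> 1%:M - M *m L = u *m u^T ->
  M^T *m u = 0 -> u != 0 ->
  exists2 t, t != 0 & isometric (metric S M E) (metric (t *: (u *m u^T)) M E).
Proof.
move=> nil EL uuE Mu u0; have [ST ET _] := (nilsoliton_metricP _ _ _ _).1 nil.
have iso := isometric_project_line ST ET EL uuE.
exists (dotcv u (S *m u)) => //; apply: contraNneq u0 => t0.
rewrite t0 scale0r in iso; apply/eqP.
have [] := nilsoliton_ker (u := u) (v := 0) (isometric_nilsoliton iso nil) => //.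
  by rewrite mul0mx mulmx0 addr0.
by rewrite Mu mulmx0 addr0.
Qed.

End Isometries.

(** * Congruence of symmetric matrices *)

Section Congruence.
Variable F : fieldType.

Definition congruent n (A B : 'M[F]_n) := exists2 K, K \in unitmx & A = K^T *m B *m K.

Lemma congruent_refl n (A : 'M_n) : congruent A A.
Proof. by exists 1%:M; rewrite ?unitmx1 // trmx1 mul1mx mulmx1. Qed.

Lemma congruent_trans n (A B C : 'M_n) : congruent A B -> congruent B C -> congruent A C.
Proof.
move=> [K uK ->] [L uL ->]; exists (L *m K); first by rewrite unitmx_mul uK uL.
by rewrite trmx_mul !mulmxA.
Qed.

Lemma congruent_sym n (A B : 'M_n) : congruent A B -> congruent B A.
Proof.
move=> [K uK ->]; exists (invmx K); first by rewrite unitmx_inv.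
by rewrite !mulmxA -trmx_mul mulmxV // trmx1 mul1mx mulmxK.
Qed.

Lemma congruent_mul n (A K : 'M_n) : K \in unitmx -> congruent A (K *m A *m K^T).
Proof.
by move=> uK; apply: congruent_sym; exists K^T; rewrite ?unitmx_tr ?trmxK.
Qed.

Lemma congruent_tr n (A B : 'M_n) : congruent A B -> A^T = A -> B^T = B.
Proof. by move=> /congruent_sym[K _ ->] AT; rewrite !trmx_mul trmxK AT mulmxA. Qed.

Lemma form_delta n (A : 'M[F]_n) i j :
  ((delta_mx 0 i : 'rV_n) *m A *m (delta_mx 0 j : 'rV_n)^T) 0 0 = A i j.
Proof. by rewrite trmx_delta -colE -rowE !mxE. Qed.

Hypothesis two_neq0 : 2 != 0 :> F.

Lemma sym_form_neq0 n (A : 'M[F]_n) : A^T = A -> A != 0 ->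
  exists u : 'rV_n, (u *m A *m u^T) 0 0 != 0.
Proof.
move=> AT A0.
have [i diag_i|diag0] := pickP (fun i => A i i != 0).
  by exists (delta_mx 0 i); rewrite form_delta.
have /matrix0Pn[i [j Aij]] := A0; exists (delta_mx 0 i + delta_mx 0 j).
have Aii k : A k k = 0 by apply/eqP; have := diag0 k; rewrite /= => /negbFE.
have Aji : A j i = A i j by rewrite -[in LHS]AT mxE.
rewrite linearD /= mulmxDr !mulmxDl mxE [X in X + _]mxE [X in _ + X]mxE !form_delta !Aii Aji.
by rewrite addr0 add0r -mulr2n -mulr_natl mulf_neq0.
Qed.

Lemma congruent_corner_neq0 n (A : 'M[F]_n.+1) : A^T = A -> A != 0 ->
  exists2 B, congruent A B & B 0 0 != 0.
Proof.
move=> AT A0; have [u uAu] := sym_form_neq0 AT A0.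
have u0 : u != 0 by apply: contraNneq uAu => ->; rewrite !mul0mx mxE.
pose K := row_ebase u; exists (K *m A *m K^T).
  exact/congruent_mul/row_ebase_unit.
apply: contraNneq uAu => KAK0.
pose e0 : 'rV[F]_n.+1 := delta_mx 0 0.
have -> : u = col_ebase u 0 0 *: (e0 *m K).
  rewrite -mul_scalar_mx -mx11_scalar mulmxA -{1}[u]mulmx_ebase rank_rV u0.
  by congr (_ *m _ *m _); apply/matrixP => i j; rewrite !ord1 !mxE eq_sym andbT.
have rowKE : e0 *m K *m A *m (e0 *m K)^T = e0 *m (K *m A *m K^T) *m e0^T.
  by rewrite trmx_mul !mulmxA.
by rewrite linearZ /= -!scalemxAl -scalemxAr scalerA rowKE mxE form_delta KAK0 mulr0.
Qed.

Lemma congruent_schur n (a : F) (r : 'rV_n) (D : 'M_n) : a != 0 ->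
  congruent (block_mx a%:M r r^T D) (block_mx a%:M 0 0 (D - a^-1 *: (r^T *m r))).
Proof.
move=> a0; exists (block_mx 1%:M (a^-1 *: r) 0 1%:M).
  by rewrite unitmxE det_ublock !det1 mulr1 unitr1.
rewrite tr_block_mx !mulmx_block !trmx1 trmx0 !(mulmx0, mul0mx, mul1mx, mulmx1, addr0, add0r).
rewrite mul_scalar_mx mul_mx_scalar [(_ *: r)^T]linearZ /= !scalerA mulfV // !scale1r.
by rewrite -scalemxAr addrC subrK.
Qed.

Lemma congruent_block_diag n (a : F) (D D' : 'M_n) :
  congruent D D' -> congruent (block_mx a%:M 0 0 D) (block_mx (a%:M : 'M_1) 0 0 D').
Proof.
move=> [K uK ->]; exists (block_mx 1%:M 0 0 K).
  by rewrite unitmxE det_ublock det1 mul1r -unitmxE.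
rewrite tr_block_mx !mulmx_block !trmx1 !trmx0.
by rewrite !(mulmx0, mul0mx, mul1mx, mulmx1, addr0, add0r).
Qed.

Lemma sym_congruent_diag n (A : 'M[F]_n) : A^T = A -> exists d, congruent A (diag_mx d).
Proof.
elim: n A => [|n IHn] A AT.
  by exists 0; rewrite [A]flatmx0 [diag_mx _]flatmx0; exact: congruent_refl.
have [->|A0] := eqVneq A 0; first by exists 0; rewrite linear0; exact: congruent_refl.
have [B AB B00] := congruent_corner_neq0 AT A0; have BT := congruent_tr AB AT.
pose D : 'M_(1 + n) := B; have DT : D^T = D by [].
pose a := ulsubmx D 0 0; pose r := ursubmx D.
have DE : D = block_mx a%:M r r^T (drsubmx D) by rewrite -mx11_scalar trmx_ursub DT submxK.
have a0 : a != 0 by rewrite /a !mxE !lshift0.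
have [d dE] : exists d, congruent (drsubmx D - a^-1 *: (r^T *m r)) (diag_mx d).
  apply: IHn; rewrite linearB linearZ /= trmx_mul trmxK.
  by rewrite trmx_drsub DT.
exists (row_mx a%:M d); apply: (congruent_trans AB).
have -> : B = block_mx a%:M r r^T (drsubmx D) by [].
have -> : diag_mx (row_mx a%:M d) = block_mx a%:M 0 0 (diag_mx d).
  by rewrite diag_mx_row; congr (block_mx _ _ _ _); apply/matrixP => i j; rewrite !ord1 !mxE.
exact: congruent_trans (congruent_schur _ _ a0) (congruent_block_diag a dE).
Qed.

End Congruence.

Section Sylvester.
Variable R : rcfType.

Lemma sqr_scale_sg (x : R) : exists2 k, 0 < k & k ^+ 2 * x = Num.sg x.
Proof.
have [->|x0] := eqVneq x 0; first by exists 1; rewrite ?ltr01 // sgr0 mulr0.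
exists (Num.sqrt `|x|)^-1; first by rewrite invr_gt0 sqrtr_gt0 normr_gt0.
by rewrite exprVn sqr_sqrtr // [X in _ * X]numEsg mulrC mulfK ?normr_eq0.
Qed.

Lemma congruent_diag_sg n (d : 'rV[R]_n) :
  congruent (diag_mx d) (diag_mx (map_mx Num.sg d)).
Proof.
have k_ex i : exists k, (0 < k) && (k ^+ 2 * d 0 i == Num.sg (d 0 i)).
  by have [k k0 kE] := sqr_scale_sg (d 0 i); exists k; rewrite k0; apply/eqP.
pose k := \row_i xchoose (k_ex i); apply: congruent_sym; exists (diag_mx k).
  rewrite unitmxE unitfE det_diag; apply/prodf_neq0 => i _.
  by rewrite mxE gt_eqF //; case/andP: (xchooseP (k_ex i)).
rewrite tr_diag_mx !mulmx_diag; congr diag_mx; apply/rowP => i; rewrite !mxE.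
transitivity (xchoose (k_ex i) ^+ 2 * d 0 i); last by ring.
by case/andP: (xchooseP (k_ex i)) => _ /eqP.
Qed.

Lemma sylvester n (A : 'M[R]_n) : A^T = A ->
  exists2 d : 'rV[R]_n, forall i, d 0 i \in [:: 0; 1; -1] & congruent A (diag_mx d).
Proof.
move=> AT; have two_neq0 : 2 != 0 :> R by rewrite pnatr_eq0.
have [d Ad] := sym_congruent_diag two_neq0 AT.
exists (map_mx Num.sg d); last exact: congruent_trans Ad (congruent_diag_sg d).
by move=> i; rewrite mxE !inE; case: sgrP; rewrite ?eqxx ?orbT.
Qed.

End Sylvester.

Section InertiaForms.
Variable R : realType.

Lemma mx3E (a b c d e f g h i : R) :
  mx3 [:: [:: a; b; c]; [:: d; e; f]; [:: g; h; i]] = mat33 a b c d e f g h i.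
Proof. by []. Qed.

Lemma diag3E (a b c : R) : diag3 a b c = mat33 a 0 0 0 b 0 0 0 c.
Proof. by []. Qed.

Lemma scale_diag3 (k a b c : R) : k *: diag3 a b c = diag3 (k * a) (k * b) (k * c).
Proof. by rewrite !diag3E scale_mat33 !mulr0. Qed.

Lemma scale_E30 (k : R) : k *: E30 R = diag3 k k k.
Proof. by rewrite scale_diag3 mulr1. Qed.

Lemma scale_E21 (k : R) : k *: E21 R = diag3 k k (- k).
Proof. by rewrite scale_diag3 mulr1 mulrN1. Qed.

Lemma scale_E20 (k : R) : k *: E20 R = diag3 0 k k.
Proof. by rewrite scale_diag3 mulr0 mulr1. Qed.

Lemma scale_E10 (k : R) : k *: E10 R = diag3 0 0 k.
Proof. by rewrite scale_diag3 mulr0 mulr1. Qed.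

Variant inertia_form : 'M[R]_3 -> Prop :=
| Inertia30 (b : bool) : inertia_form ((-1) ^+ b *: E30 R)
| Inertia21 (b : bool) : inertia_form ((-1) ^+ b *: E21 R)
| Inertia20 (b : bool) : inertia_form ((-1) ^+ b *: E20 R)
| Inertia11 : inertia_form (E11 R)
| Inertia10 (b : bool) : inertia_form ((-1) ^+ b *: E10 R)
| Inertia00 : inertia_form 0.

Definition has_inertia_form E := exists2 F, congruent E F & inertia_form F.

Lemma congruent_has_inertia_form E F :
  congruent E F -> has_inertia_form F -> has_inertia_form E.
Proof. by move=> EF [G FG GF]; exists G => //; exact: congruent_trans EF FG. Qed.

Lemma has_inertia_form_swap12 (a b c : R) :
  has_inertia_form (diag3 b a c) -> has_inertia_form (diag3 a b c).
Proof.
apply: congruent_has_inertia_form; exists (mat33 0 1 0 1 0 0 0 0 1).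
  by rewrite unitmxE det_mat33 unitfE; apply: ltr0_neq0; lra.
by rewrite !diag3E tr_mat33 !mul_mat33; congr mat33; ring.
Qed.

Lemma has_inertia_form_swap23 (a b c : R) :
  has_inertia_form (diag3 a c b) -> has_inertia_form (diag3 a b c).
Proof.
apply: congruent_has_inertia_form; exists (mat33 1 0 0 0 0 1 0 1 0).
  by rewrite unitmxE det_mat33 unitfE; apply: ltr0_neq0; lra.
by rewrite !diag3E tr_mat33 !mul_mat33; congr mat33; ring.
Qed.

Lemma has_inertia_form_refl E F : inertia_form F -> E = F -> has_inertia_form E.
Proof. by move=> HF ->; exists F => //; exact: congruent_refl. Qed.

Lemma has_inertia_form_rank2 (b c : bool) : has_inertia_form (diag3 0 ((-1) ^+ b) ((-1) ^+ c)).
Proof.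
have [->|bc] := eqVneq c b.
  exact: (has_inertia_form_refl (Inertia20 b)) (esym (scale_E20 _)).
wlog b0 : b c bc / b = false => [wlog_b|].
  case: b bc => bc; last exact: wlog_b.
  by apply: has_inertia_form_swap23; apply: wlog_b; [rewrite eq_sym|move: bc; case: c].
by move: bc; rewrite b0; case: c => // _; apply: (has_inertia_form_refl Inertia11).
Qed.

Lemma has_inertia_form_rank3 (a b c : bool) :
  has_inertia_form (diag3 ((-1) ^+ a) ((-1) ^+ b) ((-1) ^+ c)).
Proof.
have twice (s t : bool) : has_inertia_form (diag3 ((-1) ^+ s) ((-1) ^+ s) ((-1) ^+ t)).
  have [->|ts] := eqVneq t s.
    exact: (has_inertia_form_refl (Inertia30 s)) (esym (scale_E30 _)).
  apply: (has_inertia_form_refl (Inertia21 s)).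
  have -> : t = ~~ s by move: ts; case: s; case: t.
  by rewrite scale_E21 signrN.
have [->|ab] := eqVneq a b; first exact: twice.
have [->|ac] := eqVneq a c; first by apply: has_inertia_form_swap23; exact: twice.
have -> : b = c by move: ab ac; case: a; case: b; case: c.
by apply: has_inertia_form_swap12; apply: has_inertia_form_swap23; exact: twice.
Qed.

Lemma sym_has_inertia_form (E : 'M[R]_3) : E^T = E -> has_inertia_form E.
Proof.
move=> /sylvester[d d_sign Ed]; apply: (congruent_has_inertia_form Ed).
rewrite diag_mat33 -diag3E.
have signP i : d 0 i = 0 \/ exists b : bool, d 0 i = (-1) ^+ b.
  by move: (d_sign i); rewrite !inE => /or3P[]/eqP->;
    [left|right; exists false|right; exists true].
have rank1 (b : bool) : has_inertia_form (diag3 0 0 ((-1) ^+ b)).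
  exact: (has_inertia_form_refl (Inertia10 b)) (esym (scale_E10 _)).
have null_first i j : has_inertia_form (diag3 0 (d 0 i) (d 0 j)).
  have [->|[b ->]] := signP i; have [->|[c ->]] := signP j; last exact: has_inertia_form_rank2.
  - by apply: (has_inertia_form_refl Inertia00); rewrite [RHS]zero_mat33.
  - exact: rank1.
  - by apply: has_inertia_form_swap23; exact: rank1.
have [->|[a aE]] := signP (inord 0); first exact: null_first.
have [->|[b bE]] := signP (inord 1); first by apply: has_inertia_form_swap12; exact: null_first.
have [->|[c cE]] := signP (inord 2); last by rewrite aE bE cE; exact: has_inertia_form_rank3.
by apply: has_inertia_form_swap23; apply: has_inertia_form_swap12; exact: null_first.
Qed.

End InertiaForms.

(** * The families of nilsolitons *)

Lemma involutive_invmx (F : comUnitRingType) n (A : 'M[F]_n) : A *m A = 1%:M -> invmx A = A.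
Proof. by move=> AA; rewrite -[LHS]mulmx1 -AA mulKmx // (mulmx1_unit AA).1. Qed.

Section Families.
Variable R : realType.
Implicit Types (g : 'M[R]_6) (S M E : 'M[R]_3) (gamma : R).

Lemma nilsoliton_orthogonal E (l : R) : E^T = E -> E \in unitmx -> l != 0 ->
  nilsoliton (metric (l *: invmx E) 0 E) (- (5 * \det E / (2 * l ^+ 2))).
Proof.
move=> ET uE l0; apply/nilsoliton_metricP; split=> //.
  by rewrite linearZ /= trmx_inv ET.
exists (l^-1 *: E), 0, (invmx E); split; first by rewrite linearZ /= ET.
  apply/metric_mul_eq1; rewrite !trmx0 !(mulmx0, mul0mx, addr0, add0r) mulmxV //.
  by rewrite -scalemxAl -scalemxAr scalerA mulfV // scale1r mulVmx.
rewrite cofmxZ -scalemxAl -{2}ET mul_cofmx_tr scale_scalar_mx; congr (_%:M).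
by field.
Qed.

Lemma nilsoliton_orthogonal_inv S E gamma : E \in unitmx -> nilsoliton (metric S 0 E) gamma ->
  exists2 l, l != 0 & S = l *: invmx E.
Proof.
move=> uE /nilsoliton_metricP[ST _ [P [Q [T [_ ginv cE]]]]].
have [SP _ _ _] := (metric_mul_eq1 _ _ _ _ _ _).1 ginv; rewrite mul0mx addr0 in SP.
set c := - _ in cE; have uS := (mulmx1_unit SP).1.
have ES : E *m S = (c * \det S)%:M.
  have -> : E = c *: cofmx S by rewrite -[LHS]mul1mx -cofmx1 -SP cofmxM -mulmxA cE mul_mx_scalar.
  by rewrite -scalemxAl -{2}ST mul_cofmx_tr scale_scalar_mx.
exists (c * \det S); last by rewrite -[LHS](mulKmx uE) ES mul_mx_scalar.
apply/eqP => l0; have : E *m S \in unitmx by rewrite unitmx_mul uE uS.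
by rewrite ES l0 raddf0 unitmxE det0 unitr0.
Qed.

Definition rank2_metric (x y z a b : R) :=
  metric (mat33 0 0 0 0 x y 0 y z) (M2 R) (diag3 0 a b).

Lemma nilsoliton_rank2 x y z a b : x * z - y ^+ 2 != 0 -> a != 0 -> b != 0 ->
  nilsoliton (rank2_metric x y z a b) 0.
Proof.
move=> d0 a0 b0; rewrite /rank2_metric /M2 !diag3E; apply/nilsoliton_metricP.
split; rewrite ?tr_mat33 //; set d := x * z - y ^+ 2 in d0.
exists (mat33 0 0 0 0 (z / d) (- y / d) 0 (- y / d) (x / d)), (mat33 1 0 0 0 0 0 0 0 0),
  (mat33 0 0 0 0 a^-1 0 0 0 b^-1).
rewrite tr_mat33; split=> //.
  apply/metric_mul_eq1; rewrite !tr_mat33 !mul_mat33 !add_mat33 scalar_mat33 zero_mat33.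
  by split; congr mat33; rewrite /d; field; rewrite ?d0 ?a0 ?b0.
by rewrite cofmx_mat33 mul_mat33 scalar_mat33; congr mat33; field.
Qed.

(* Here [e_2] spans the annihilator of the pairing of the generators with the kernel of
   the metric on the centre. *)
Definition rank1_metric (t p q r s h : R) :=
  metric (diag3 0 t 0) (mat33 p q 0 0 0 0 r s 0) (diag3 0 0 h).

Lemma nilsoliton_rank1 t p q r s h : p * s - q * r != 0 -> t != 0 -> h != 0 ->
  nilsoliton (rank1_metric t p q r s h) 0.
Proof.
move=> d0 t0 h0; rewrite /rank1_metric !diag3E; apply/nilsoliton_metricP.
split; rewrite ?tr_mat33 //; set d := p * s - q * r in d0.
exists (mat33 0 0 0 0 t^-1 0 0 0 0), (mat33 (s / d) (- r / d) 0 0 0 0 (- q / d) (p / d) 0),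
  (mat33 0 0 0 0 0 0 0 0 h^-1).
rewrite tr_mat33; split=> //.
  apply/metric_mul_eq1; rewrite !tr_mat33 !mul_mat33 !add_mat33 scalar_mat33 zero_mat33.
  by split; congr mat33; rewrite /d; field; rewrite ?d0 ?t0 ?h0.
by rewrite cofmx_mat33 mul_mat33 scalar_mat33; congr mat33; field.
Qed.

(* Here that annihilator is spanned by [e_3]. *)
Definition rank1_flat_metric (t p q r s h : R) :=
  metric (diag3 0 0 t) (mat33 p q 0 r s 0 0 0 0) (diag3 0 0 h).

Lemma nilsoliton_rank1_flat t p q r s h : p * s - q * r != 0 -> t != 0 -> h != 0 ->
  nilsoliton (rank1_flat_metric t p q r s h) 0.
Proof.
move=> d0 t0 h0; rewrite /rank1_flat_metric !diag3E; apply/nilsoliton_metricP.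
split; rewrite ?tr_mat33 //; set d := p * s - q * r in d0.
exists (mat33 0 0 0 0 0 0 0 0 t^-1), (mat33 (s / d) (- r / d) 0 (- q / d) (p / d) 0 0 0 0),
  (mat33 0 0 0 0 0 0 0 0 h^-1).
rewrite tr_mat33; split=> //.
  apply/metric_mul_eq1; rewrite !tr_mat33 !mul_mat33 !add_mat33 scalar_mat33 zero_mat33.
  by split; congr mat33; rewrite /d; field; rewrite ?d0 ?t0 ?h0.
by rewrite cofmx_mat33 mul_mat33 scalar_mat33; congr mat33; field.
Qed.

Lemma nilsoliton_rank0 M : M \in unitmx -> nilsoliton (metric 0 M 0) 0.
Proof.
move=> uM; apply/nilsoliton_metricP; rewrite trmx0; split=> //.
exists 0, (invmx M)^T, 0; rewrite trmx0; split=> //; last first.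
  by rewrite mulmx0 mulr0 mul0r oppr0 raddf0.
apply/metric_mul_eq1; rewrite trmxK !(mulmx0, mul0mx, addr0, add0r) mulmxV //.
by rewrite -trmx_mul mulVmx // trmx1.
Qed.

(* The shear moving the annihilator [e_2 - e_3] of the columns of [M1 l] to [e_2]. *)
Lemma isometric_M1 (l t h : R) : h != 0 ->
  isometric (metric (diag3 0 0 t) (M1 l) (diag3 0 0 h)) (rank1_metric t 0 l 1 0 h).
Proof.
move=> h0; rewrite /rank1_metric /M1 mx3E !diag3E.
apply: (isometric_block (B := mat33 1 0 0 0 1 0 0 (-1) 1)
  (C := mat33 0 t (- t / 2) (- l / (2 * h)) 0 0 (- l / h) 0 0)).
- by rewrite tr_mat33.
- by rewrite unitmxE det_mat33 unitfE; apply: lt0r_neq0; lra.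
- by rewrite !tr_mat33 !mul_mat33 !add_mat33; congr mat33; field.
- by rewrite !tr_mat33 cofmx_mat33 !mul_mat33 add_mat33 mul_mat33; congr mat33; field.
- by rewrite cofmx_mat33 tr_mat33 !mul_mat33; congr mat33; field.
Qed.

Definition listed g gamma :=
  [\/ family_i g gamma, family_ii g gamma, family_iii g gamma | omitted_family g gamma].

Lemma nilsoliton_sign_diag (a b c l : R) :
  a ^+ 2 = 1 -> b ^+ 2 = 1 -> c ^+ 2 = 1 -> l != 0 ->
  nilsoliton (metric (diag3 (l * a) (l * b) (l * c)) 0 (diag3 a b c))
    (- (5 * (a * b * c) / (2 * l ^+ 2))).
Proof.
move=> a1 b1 c1 l0; set E := diag3 a b c.
have ET : E^T = E by rewrite /E diag3E tr_mat33.
have EE : E *m E = 1%:M.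
  rewrite /E diag3E mul_mat33 scalar_mat33.
  by congr mat33; rewrite ?mulr0 ?mul0r ?add0r ?addr0.
have := nilsoliton_orthogonal ET (mulmx1_unit EE).1 l0; rewrite involutive_invmx //.
have -> : \det E = a * b * c by rewrite /E diag3E det_mat33; ring.
by rewrite scale_diag3.
Qed.

Lemma family_i_nilsoliton g gamma : family_i g gamma -> nilsoliton g gamma.
Proof.
case=> l l0; have sqr1 := expr1n R 2.
by have := nilsoliton_sign_diag sqr1 sqr1 sqr1 l0; rewrite !mulr1.
Qed.

Lemma family_ii_nilsoliton g gamma : family_ii g gamma -> nilsoliton g gamma.
Proof.
case=> l l0; have sqr1 := expr1n R 2; have sqrN1 : (-1) ^+ 2 = 1 :> R by rewrite sqrrN.
by have := nilsoliton_sign_diag sqr1 sqr1 sqrN1 l0; rewrite !(mulr1, mulrN, mulNr, opprK).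
Qed.

Lemma family_iii_nilsoliton g gamma : family_iii g gamma -> nilsoliton g gamma.
Proof.
case=> [b x z x0 z0|x z x0 z0|x x0|z z0|b c l l0].
- rewrite scale_E20; apply: (@nilsoliton_rank2 x 0 z); rewrite ?signr_eq0 //.
  by rewrite expr0n subr0 mulf_neq0.
- apply: (@nilsoliton_rank2 x 0 z); rewrite ?oppr_eq0 ?oner_eq0 //.
  by rewrite expr0n subr0 mulf_neq0.
- apply: nilsoliton_rank2; rewrite ?oppr_eq0 ?oner_eq0 // mulr0 sub0r oppr_eq0 sqrf_eq0.
  by rewrite mulf_neq0 ?normr_eq0 ?invr_eq0 ?pnatr_eq0.
- apply: nilsoliton_rank2; rewrite ?oppr_eq0 ?oner_eq0 // mul0r sub0r oppr_eq0 sqrf_eq0.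
  by rewrite mulf_neq0 ?normr_eq0 ?invr_eq0 ?pnatr_eq0.
- rewrite !scale_E10; apply: isometric_nilsoliton (isometric_sym (isometric_M1 _ _ _)) _.
    by rewrite signr_eq0.
  by apply: nilsoliton_rank1; rewrite ?signr_eq0 // mulr1 mul0r sub0r oppr_eq0.
Qed.

Lemma omitted_nilsoliton g gamma : omitted_family g gamma -> nilsoliton g gamma.
Proof.
have sqr1 := expr1n R 2; have sqrN1 : (-1) ^+ 2 = 1 :> R by rewrite sqrrN.
case=> [l l0|l l0|a b b0|b c l l0|b c p q r s d0|M uM].
- have nl0 : - l != 0 by rewrite oppr_eq0.
  have := nilsoliton_sign_diag sqrN1 sqrN1 sqrN1 nl0.
  by rewrite -scaleN1r scale_E30 sqrrN !(mulr1, mul1r, mulrN, mulNr, opprK).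
- have nl0 : - l != 0 by rewrite oppr_eq0.
  have := nilsoliton_sign_diag sqrN1 sqrN1 sqr1 nl0.
  by rewrite -scaleN1r scale_E21 sqrrN !(mulr1, mul1r, mulrN, mulNr, opprK).
- apply: nilsoliton_rank2; rewrite ?oppr_eq0 ?oner_eq0 // mulrN -opprD oppr_eq0.
  by rewrite -expr2 gt_eqF // ltr_wpDl ?sqr_ge0 // lt0r sqrf_eq0 b0 sqr_ge0.
- rewrite scale_E10 scale_diag3 mulr0 mulr1.
  by apply: nilsoliton_rank1; rewrite ?signr_eq0 // mul1r mulr0 subr0.
- by rewrite !scale_E10; apply: nilsoliton_rank1_flat; rewrite ?signr_eq0.
- exact: nilsoliton_rank0.
Qed.

Lemma listed_nilsoliton g gamma : listed g gamma -> nilsoliton g gamma.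
Proof.
by case; [exact: family_i_nilsoliton|exact: family_ii_nilsoliton
  |exact: family_iii_nilsoliton|exact: omitted_nilsoliton].
Qed.

End Families.

(** * Classification up to isometry *)

Section Classifiable.
Variable R : realType.
Implicit Types (g h : 'M[R]_6) (S M E B C : 'M[R]_3).

Definition classifiable g :=
  forall gamma, nilsoliton g gamma -> exists2 h, listed h gamma & isometric g h.

Lemma listed_classifiable h gamma : listed h gamma -> classifiable h.
Proof.
move=> hl gamma' nil; exists h; last exact: isometric_refl.
by rewrite (nilsoliton_uniq nil (listed_nilsoliton hl)).
Qed.

Lemma isometric_classifiable g h : isometric g h -> classifiable h -> classifiable g.
Proof.
move=> gh hc gamma nil; have [k kl hk] := hc _ (isometric_nilsoliton gh nil).
by exists k => //; exact: isometric_trans gh hk.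
Qed.

Lemma classifiableI g :
  (forall gamma, nilsoliton g gamma -> classifiable g) -> classifiable g.
Proof. by move=> gc gamma nil; exact: (gc _ nil _ nil). Qed.

(* Related by an automorphism, whatever the metric [S] on the generators. *)
Definition pairing_equiv M E M' E' := exists B C,
  [/\ B \in unitmx, M' = (B^T *m M + C^T *m E) *m cofmx B
    & E' = (cofmx B)^T *m E *m cofmx B].

Lemma pairing_equiv_isometric S M E M' E' : E^T = E -> pairing_equiv M E M' E' ->
  exists S', isometric (metric S M E) (metric S' M' E').
Proof.
move=> ET [B [C [uB ME EE]]]; eexists.
exact: (isometric_block ET uB erefl ME EE).
Qed.

Lemma pairing_equiv_classifiable M E M' E' : E^T = E -> pairing_equiv M E M' E' ->
  (forall S, classifiable (metric S M' E')) -> forall S, classifiable (metric S M E).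
Proof.
move=> ET MM' M'_class S; have [S' iso] := pairing_equiv_isometric S ET MM'.
exact: isometric_classifiable iso (M'_class S').
Qed.

Lemma pairing_equiv_shear M E M' C : M' = M + C^T *m E -> pairing_equiv M E M' E.
Proof.
move=> ->; exists 1%:M, C; rewrite unitmx1 cofmx1 trmx1 mul1mx !mulmx1.
by rewrite mul1mx.
Qed.

Lemma pairing_equiv_frame M E B : B \in unitmx ->
  pairing_equiv M E (B^T *m M *m cofmx B) ((cofmx B)^T *m E *m cofmx B).
Proof. by move=> uB; exists B, 0; rewrite trmx0 mul0mx addr0. Qed.

(* Automorphisms act on the centre by cofactor matrices; up to sign, every invertible [L]
   is the cofactor matrix of a multiple of [cofmx L], as [cofmx (cofmx L) = \det L *: L]. *)
Lemma congruent_pairing_equiv M E E' : congruent E E' -> exists M', pairing_equiv M E M' E'.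
Proof.
move=> /congruent_sym[L uL ->]; have dL : \det L != 0 by rewrite -unitfE -unitmxE.
have [k k0 kE] := sqr_scale_sg (\det L); pose B := k *: cofmx L.
have BE : cofmx B = Num.sg (\det L) *: L by rewrite cofmxZ cofmx_cofmx scalerA kE.
have uB : B \in unitmx by rewrite unitmxZ ?unitfE ?gt_eqF // cofmx_unit.
exists (B^T *m M *m cofmx B).
have -> : L^T *m E *m L = (cofmx B)^T *m E *m cofmx B; last exact: pairing_equiv_frame.
rewrite BE [(_ *: L)^T]linearZ /= -!scalemxAl -scalemxAr scalerA -expr2 sqr_sg dL.
by rewrite scale1r.
Qed.

End Classifiable.

Section RankThree.
Variable R : realType.
Implicit Types (S M E : 'M[R]_3).

Lemma classifiable_orthogonal E : E^T = E -> E *m E = 1%:M ->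
  (forall l, l != 0 -> exists gamma, listed (metric (l *: E) 0 E) gamma) ->
  forall S M, classifiable (metric S M E).
Proof.
move=> ET EE scaled_listed S M.
have shear : pairing_equiv M E 0 E.
  apply: (pairing_equiv_shear (C := - (E *m M^T))).
  by rewrite linearN /= trmx_mul trmxK ET mulNmx -mulmxA EE mulmx1 subrr.
apply: (pairing_equiv_classifiable ET shear) => {}S.
apply: classifiableI => gamma nil.
have [l l0 ->] := nilsoliton_orthogonal_inv (mulmx1_unit EE).1 nil.
by rewrite involutive_invmx //; have [gamma' /listed_classifiable] := scaled_listed l l0.
Qed.

Lemma classifiable_E30 (b : bool) S M : classifiable (metric S M ((-1) ^+ b *: E30 R)).
Proof.
apply: classifiable_orthogonal S M.
- by rewrite scale_E30 diag3E tr_mat33.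
- rewrite scale_E30 diag3E mul_mat33 scalar_mat33 !(mulr0, mul0r, add0r, addr0).
  by rewrite -expr2 sqrr_sign.
case: b => l l0; last first.
  by rewrite scale1r scale_E30; exists (- (5 / (2 * l ^+ 2))); constructor 1.
rewrite expr1 scalerA mulrN1 scale_E30 scaleN1r; exists (5 / (2 * (- l) ^+ 2)).
by constructor 4; apply: Omitted_30; rewrite oppr_eq0.
Qed.

Lemma classifiable_E21 (b : bool) S M : classifiable (metric S M ((-1) ^+ b *: E21 R)).
Proof.
apply: classifiable_orthogonal S M.
- by rewrite scale_E21 diag3E tr_mat33.
- rewrite scale_E21 diag3E mul_mat33 scalar_mat33 !(mulr0, mul0r, add0r, addr0).
  by rewrite mulrNN -expr2 sqrr_sign.
case: b => l l0; last first.
  by rewrite scale1r scale_E21; exists (5 / (2 * l ^+ 2)); constructor 2.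
rewrite expr1 scalerA mulrN1 scale_E21 scaleN1r; exists (- (5 / (2 * (- l) ^+ 2))).
by constructor 4; apply: Omitted_21; rewrite oppr_eq0.
Qed.

End RankThree.

Section RankTwo.
Variable R : realType.
Implicit Types (S M E : 'M[R]_3).

(* Put [q := Q *m w]. Then [P *m m = 0], so [S *m P = 1 - m *m q^T] with [q^T *m m = 1],
   whose cofactor matrix is [q *m m^T]; it is killed by [E] since [cofmx P *m E = 0]. *)
Lemma nilsoliton_ker_column S E (m w : 'cV[R]_3) gamma : w != 0 -> E *m w = 0 ->
  nilsoliton (metric S (m *m w^T) E) gamma -> E *m m = 0.
Proof.
move=> w0 Ew nil.
have ww0 : dotcv w w != 0 by rewrite dotcv_eq0.
have dE : \det E = 0.
  apply/eqP; rewrite -det_tr; apply/det0P; exists w^T.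
    by rewrite -(inj_eq trmx_inj) trmxK trmx0.
  by rewrite -trmx_mul Ew trmx0.
have m0 : m != 0.
  apply: contraNneq w0 => m0; apply/eqP.
  by have [] := nilsoliton_ker (u := 0) (v := w) nil; rewrite ?m0 ?mul0mx ?mulmx0 ?Ew ?addr0.
have [_ ET [P [Q [T [PT ginv cE]]]]] := (nilsoliton_metricP _ _ _ _).1 nil.
have [SP _ MP _] := (metric_mul_eq1 _ _ _ _ _ _).1 ginv.
rewrite (nilsoliton_singular dE nil) mulr0 mul0r oppr0 raddf0 in cE.
have dotE (u v : 'cV[R]_3) : u^T *m v = (dotcv u v)%:M by rewrite [LHS]mx11_scalar.
have Pm : P *m m = 0.
  apply: trmx_inj; rewrite trmx_mul PT trmx0.
  have := congr1 (mulmx w^T) MP; rewrite mulmxDr trmx_mul trmxK !mulmxA.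
  rewrite -[w^T *m E]trmxK trmx_mul ET trmxK Ew trmx0 mul0mx addr0 mulmx0 dotE mul_scalar_mx.
  by rewrite -scalemxAl => /eqP; rewrite scaler_eq0 (negbTE ww0) => /eqP.
pose q := Q *m w.
have {}SP : S *m P = 1%:M - m *m q^T.
  by rewrite -SP -mulmxA trmx_mul addrK.
clearbody q.
have mq1 : dotcv m q = 1.
  have := congr1 (mulmx^~ m) SP; rewrite -mulmxA Pm mulmx0 mulmxBl mul1mx -mulmxA dotE.
  rewrite mul_mx_scalar => /esym/eqP; rewrite -[X in X - _]scale1r -scalerBl scaler_eq0.
  rewrite (negbTE m0) orbF subr_eq0 => /eqP ->; exact: dotcvC.
have qmE : q *m m^T *m E = 0.
  have := cofmxM S P; rewrite SP cofmx_sub_rank1 mq1 subrr raddf0 add0r => ->.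
  by rewrite -mulmxA cE mulmx0.
apply: trmx_inj; rewrite trmx_mul ET trmx0.
have := congr1 (mulmx m^T) qmE; rewrite !mulmxA dotE mq1 mulmx0 => <-.
by rewrite mul1mx.
Qed.

Lemma nilsoliton_column_axis S (m : 'cV[R]_3) a b gamma : a != 0 -> b != 0 ->
  nilsoliton (metric S (m *m (col3 1 0 0)^T) (diag3 0 a b)) gamma ->
  exists2 mu, mu != 0 & m = col3 mu 0 0.
Proof.
move=> a0 b0 nil; set E := diag3 0 a b in nil; set e1 := col3 _ _ _ in nil.
have e10 : e1 != 0 by apply/eqP; rewrite zero_col3 => /col3_inj[/eqP]; rewrite oner_eq0.
have Ee1 : E *m e1 = 0 by rewrite /E diag3E mul_mat33_col3 zero_col3; congr col3; ring.
have : m != 0.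
  apply: contraNneq e10 => m0; apply/eqP.
  by have [] := nilsoliton_ker (u := 0) (v := e1) nil; rewrite ?m0 ?mul0mx ?mulmx0 ?Ee1 ?addr0.
have := nilsoliton_ker_column e10 Ee1 nil; case/col3P: m {nil} => mu m2 m3.
rewrite /E diag3E mul_mat33_col3 zero_col3 => /col3_inj[_ + +].
rewrite !mul0r !add0r addr0 => /eqP; rewrite mulf_eq0 (negbTE a0) => /eqP ->.
move=> /eqP; rewrite mulf_eq0 (negbTE b0) => /eqP -> mu0.
by exists mu => //; apply: contraNneq mu0 => ->; rewrite -zero_col3.
Qed.

Lemma isometric_rank2_metric S M a b gamma : a != 0 -> b != 0 ->
  nilsoliton (metric S M (diag3 0 a b)) gamma ->
  exists x y z, isometric (metric S M (diag3 0 a b)) (rank2_metric x y z a b).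
Proof.
move=> a0 b0 nil; set E := diag3 0 a b.
have ET : E^T = E by rewrite /E diag3E tr_mat33.
pose e1 : 'cV[R]_3 := col3 1 0 0; pose m := M *m e1.
have shear : pairing_equiv M E (m *m e1^T) E.
  apply: (pairing_equiv_shear (C := - (diag3 0 a^-1 b^-1 *m M^T))).
  have e1E : e1 *m e1^T = 1%:M - diag3 0 a^-1 b^-1 *m E.
    rewrite /E !diag3E mul_col3_tr scalar_mat33 mul_mat33 opp_mat33 add_mat33.
    by congr mat33; field.
  rewrite /m -mulmxA e1E mulmxBr mulmx1 linearN /= trmx_mul trmxK mulNmx -mulmxA.
  by rewrite [in RHS]diag3E tr_mat33 -diag3E.
have [S1 iso1] := pairing_equiv_isometric S ET shear.
have [mu mu0 mE] := nilsoliton_column_axis a0 b0 (isometric_nilsoliton iso1 nil).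
have frame : pairing_equiv (m *m e1^T) E (M2 R) E.
  exists (diag3 mu mu^-1 mu^-1), 0.
  rewrite unitmxE unitfE /M2 /E !diag3E det_mat33 mE mul_col3_tr !tr_mat33 zero_mat33 tr_mat33.
  rewrite cofmx_mat33 tr_mat33 !mul_mat33 add_mat33 mul_mat33.
  split; [|by congr mat33; field|by congr mat33; field].
  by rewrite !(mulr0, mul0r, addr0, subr0) !mulf_neq0 ?invr_eq0.
have [S2 iso2] := pairing_equiv_isometric S1 ET frame.
have nil2 := isometric_nilsoliton iso2 (isometric_nilsoliton iso1 nil).
have [ST _ _] := (nilsoliton_metricP _ _ _ _).1 nil2.
have EM2 : E *m M2 R = 0.
  by rewrite /E /M2 !diag3E mul_mat33 zero_mat33; congr mat33; ring.
move: (isometric_trans (isometric_trans iso1 iso2) (isometric_project (M2 R) ST ET EM2)).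
case/sym33P: ST {nil2 iso2} => s11 s12 s13 x y z iso; exists x, y, z.
congr (isometric _ (metric _ _ _)): iso.
rewrite /M2 diag3E scalar_mat33 mul_mat33 opp_mat33 add_mat33 tr_mat33 !mul_mat33.
by congr mat33; ring.
Qed.

End RankTwo.

Section HalfAngle.
Variable R : rcfType.

(* Half angle formulas: circular for [eps = 1], hyperbolic for [eps = -1]. *)
Lemma half_angle (eps X Y : R) : X ^+ 2 + eps * Y ^+ 2 = 1 -> -1 < X ->
  exists c t, [/\ c ^+ 2 + eps * t ^+ 2 = 1, c ^+ 2 - eps * t ^+ 2 = X & 2 * c * t = Y].
Proof.
move=> XY X1; have X1p : 0 < (1 + X) / 2 by lra.
pose c := Num.sqrt ((1 + X) / 2); have c2 : c ^+ 2 = (1 + X) / 2 by rewrite sqr_sqrtr ?ltW.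
have c0 : c != 0 by rewrite gt_eqF // sqrtr_gt0.
have t2 : eps * (Y / (2 * c)) ^+ 2 = (1 - X) / 2.
  have -> : eps * (Y / (2 * c)) ^+ 2 = eps * Y ^+ 2 / (4 * c ^+ 2) by field.
  have -> : eps * Y ^+ 2 = (1 - X) * (1 + X) by rewrite -[eps * _](addKr (X ^+ 2)) XY; ring.
  by rewrite c2; field; apply/eqP; lra.
exists c, (Y / (2 * c)); rewrite t2 c2.
by split; [lra|lra|field].
Qed.

Lemma rotation_diagonalizes (a b : R) : exists c t,
  c ^+ 2 + t ^+ 2 = 1 /\ a * (c * t) + b * (c ^+ 2 - t ^+ 2) = 0.
Proof.
have [->|b0] := eqVneq b 0; first by exists 1, 0; split; ring.
pose D := Num.sqrt (a ^+ 2 + 4 * b ^+ 2).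
have b2 : 0 < b ^+ 2 by rewrite exprn_even_gt0.
have D2 : D ^+ 2 = a ^+ 2 + 4 * b ^+ 2 by rewrite sqr_sqrtr // addr_ge0 ?sqr_ge0 //; lra.
have D0 : 0 < D by rewrite sqrtr_gt0 ltr_wpDl ?sqr_ge0 //; lra.
have [||c [t [ct1 ctX ctY]]] := @half_angle 1 (a / D) (- (2 * b) / D).
- have -> : (a / D) ^+ 2 + 1 * (- (2 * b) / D) ^+ 2 = (a ^+ 2 + 4 * b ^+ 2) / D ^+ 2.
    by field; rewrite gt_eqF.
  by rewrite -D2 divff // sqrf_eq0 gt_eqF.
- by rewrite ltr_pdivlMr //; nra.
exists c, t; move: ct1 ctX; rewrite !mul1r => ct1 ->; split=> //.
have -> : c * t = 2^-1 * (2 * c * t) by field.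
by rewrite ctY; field; rewrite gt_eqF.
Qed.

Lemma boost_diagonalizes (a b : R) : b ^+ 2 < a ^+ 2 -> exists c t,
  c ^+ 2 - t ^+ 2 = 1 /\ a * (2 * c * t) + b * (c ^+ 2 + t ^+ 2) = 0.
Proof.
move=> ba; pose D := Num.sqrt (a ^+ 2 - b ^+ 2).
have D0 : 0 < D by rewrite sqrtr_gt0; lra.
have D2 : D ^+ 2 = a ^+ 2 - b ^+ 2 by rewrite sqr_sqrtr //; lra.
have [||c [t [ct1 ctX ctY]]] := @half_angle (-1) (`|a| / D) (- (Num.sg a * b) / D).
- have s2 : Num.sg a ^+ 2 = 1.
    by rewrite sqr_sg; case: eqVneq ba => // ->; rewrite expr0n ltNge sqr_ge0.
  have -> : (`|a| / D) ^+ 2 + -1 * (- (Num.sg a * b) / D) ^+ 2 =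
      Num.sg a ^+ 2 * (a ^+ 2 - b ^+ 2) / D ^+ 2.
    by rewrite normrEsg; field; rewrite gt_eqF.
  by rewrite s2 mul1r -D2 divff // sqrf_eq0 gt_eqF.
- by apply: (@lt_le_trans _ _ 0); rewrite ?ltrN10 // divr_ge0 // ltW.
exists c, t; move: ct1 ctX; rewrite !mulN1r opprK => ct1 ->; split=> //.
by rewrite ctY normrEsg; field; rewrite gt_eqF.
Qed.

End HalfAngle.

Section PlaneForms.
Variable R : realType.
Implicit Types x y z a b : R.

Lemma rank2_metric_det_neq0 x y z a b gamma :
  nilsoliton (rank2_metric x y z a b) gamma -> x * z - y ^+ 2 != 0.
Proof.
move=> /nilsoliton_metricP[_ _ [P [Q [T [_ /metric_mul_eq1[SP _ _ _] _]]]]].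
move: SP; rewrite /M2 diag3E.
case/mat33P: P => ? ? ? ? p22 p23 ? p32 p33; case/mat33P: Q => ? ? ? ? ? ? ? ? ?.
rewrite tr_mat33 !mul_mat33 add_mat33 scalar_mat33 => /mat33_inj[_ [_ e22 e23] [_ _ e33]].
have dE : (x * z - y ^+ 2) * (p22 * p33 - p23 * p32) = 1.
  transitivity ((x * p22 + y * p32) * (y * p23 + z * p33)
                - (x * p23 + y * p33) * (y * p22 + z * p32)); first by ring.
  have -> : x * p22 + y * p32 = 1 by rewrite -e22; ring.
  have -> : y * p23 + z * p33 = 1 by rewrite -e33; ring.
  have -> : x * p23 + y * p33 = 0 by rewrite -[RHS]e23; ring.
  by rewrite mul1r mul0r subr0.
by apply: contra_eq_neq dE => ->; rewrite mul0r eq_sym oner_eq0.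
Qed.

Lemma isometric_rank2_orthogonal p q r s x y z a b :
  (p * s - q * r) ^+ 2 = 1 -> a * s ^+ 2 + b * q ^+ 2 = a ->
  a * r ^+ 2 + b * p ^+ 2 = b -> a * s * r + b * p * q = 0 ->
  isometric (rank2_metric x y z a b)
    (rank2_metric (x * p ^+ 2 + 2 * y * p * r + z * r ^+ 2)
                  (x * p * q + y * (p * s + q * r) + z * r * s)
                  (x * q ^+ 2 + 2 * y * q * s + z * s ^+ 2) a b).
Proof.
set d := p * s - q * r => d1 aE bE abE; rewrite /rank2_metric /M2 !diag3E.
apply: (isometric_block (B := mat33 d 0 0 0 p q 0 r s) (C := 0)).
- by rewrite tr_mat33.
- have -> : mat33 d 0 0 0 p q 0 r s \in unitmx = (d ^+ 2 != 0).
    by rewrite unitmxE unitfE det_mat33; congr (_ != 0); rewrite /d; ring.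
  by rewrite d1 oner_eq0.
- by rewrite trmx0 !(mul0mx, mulmx0) !addr0 tr_mat33 !mul_mat33; congr mat33; ring.
- rewrite trmx0 mul0mx addr0 cofmx_mat33 tr_mat33 !mul_mat33.
  by congr mat33; try ring; transitivity (d ^+ 2); [rewrite d1|rewrite /d; ring].
- rewrite cofmx_mat33 tr_mat33 !mul_mat33; congr mat33; try ring.
  + by transitivity (d ^+ 2 * (a * s ^+ 2 + b * q ^+ 2)); [rewrite d1 aE mul1r|ring].
  + by transitivity (- d ^+ 2 * (a * s * r + b * p * q)); [rewrite abE mulr0|ring].
  + by transitivity (- d ^+ 2 * (a * s * r + b * p * q)); [rewrite abE mulr0|ring].
  + by transitivity (d ^+ 2 * (a * r ^+ 2 + b * p ^+ 2)); [rewrite d1 bE mul1r|ring].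
Qed.

Lemma rotate_rank2_metric x y z a : exists x' z',
  isometric (rank2_metric x y z a a) (rank2_metric x' 0 z' a a).
Proof.
have [c [t [ct1 ct0]]] := rotation_diagonalizes (z - x) y.
have y0 : x * c * - t + y * (c * c + - t * t) + z * t * c = 0 by rewrite -ct0; ring.
do 2!eexists; rewrite -y0; apply: isometric_rank2_orthogonal.
- by rewrite -[RHS](expr1n _ 2) -ct1; congr (_ ^+ 2); ring.
- by rewrite sqrrN -mulrDr ct1 mulr1.
- by rewrite -mulrDr addrC ct1 mulr1.
- by ring.
Qed.

Lemma boost_rank2_metric c t x y z x' y' z' a : c ^+ 2 - t ^+ 2 = 1 ->
  x' = x * c ^+ 2 + 2 * y * c * t + z * t ^+ 2 ->
  y' = x * c * t + y * (c * c + t * t) + z * t * c ->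
  z' = x * t ^+ 2 + 2 * y * t * c + z * c ^+ 2 ->
  isometric (rank2_metric x y z a (- a)) (rank2_metric x' y' z' a (- a)).
Proof.
move=> ct1 -> -> ->; apply: isometric_rank2_orthogonal.
- by rewrite -[RHS](expr1n _ 2) -ct1; congr (_ ^+ 2); ring.
- by rewrite -[RHS]mulr1 -ct1; ring.
- by rewrite -[RHS]mulr1 -ct1; ring.
- by ring.
Qed.

Lemma flip_rank2_metric x y z a b :
  isometric (rank2_metric x y z a b) (rank2_metric x (- y) z a b).
Proof.
have -> : rank2_metric x (- y) z a b =
    rank2_metric (x * 1 ^+ 2 + 2 * y * 1 * 0 + z * 0 ^+ 2)
                 (x * 1 * 0 + y * (1 * -1 + 0 * 0) + z * 0 * -1)
                 (x * 0 ^+ 2 + 2 * y * 0 * -1 + z * (-1) ^+ 2) a b.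
  by congr rank2_metric; ring.
by apply: isometric_rank2_orthogonal; ring.
Qed.

Lemma boost_lightlike (k w y m a : R) : k = 1 \/ k = -1 -> w != 0 ->
  isometric (rank2_metric (k * y + m) y (k * y - m) a (- a))
    (rank2_metric (k * (w ^+ 2 * y) + m) (w ^+ 2 * y) (k * (w ^+ 2 * y) - m) a (- a)).
Proof.
move=> k1 w0; pose c := (w + w^-1) / 2; pose t := k * ((w - w^-1) / 2).
have ct1 : c ^+ 2 - t ^+ 2 = 1 by case: k1 => kE; rewrite /c /t kE; field.
by apply: (boost_rank2_metric _ ct1); case: k1 => kE; rewrite /c /t kE; field.
Qed.

Lemma isometric_lightlike x y z : 0 < y -> (x + z) ^+ 2 = (2 * y) ^+ 2 -> x != z ->
  isometric (rank2_metric x y z 1 (-1)) (rank2_metric (x - z) (`|x - z| / 2) 0 1 (-1)) \/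
  isometric (rank2_metric x y z 1 (-1)) (rank2_metric 0 (`|z - x| / 2) (z - x) 1 (-1)).
Proof.
move=> y0 xzE xz; pose m := (x - z) / 2.
have m0 : m != 0 by rewrite mulf_neq0 ?subr_eq0 ?invr_eq0 ?pnatr_eq0.
have mE : `|x - z| / 2 = `|m| by rewrite normf_div normr_nat.
have [k k1 kE] : exists2 k, k = 1 \/ k = -1 & x + z = 2 * (k * y).
  move/eqP: xzE; rewrite eqf_sqr => /orP[]/eqP ->; [exists 1|exists (-1)]; by [left|right|ring].
pose w := Num.sqrt (`|m| / y); have my0 : 0 < `|m| / y by rewrite divr_gt0 ?normr_gt0.
have wE : w ^+ 2 * y = `|m| by rewrite sqr_sqrtr ?ltW // divfK // gt_eqF.
have w0 : w != 0 by rewrite gt_eqF // sqrtr_gt0.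
have := boost_lightlike y m 1 k1 w0; rewrite wE.
have -> : k * y + m = x by rewrite /m; lra.
have -> : k * y - m = z by rewrite /m; lra.
have xE : x - z = 2 * m by rewrite /m; field.
have zE : z - x = - (2 * m) by rewrite /m; field.
have [km|km] : k * `|m| = m \/ k * `|m| = - m.
  by case: k1 => ->; rewrite ?mul1r ?mulN1r; case: (ger0P m); rewrite ?opprK;
    [left|right|right|left].
- rewrite km subrr => iso; left; rewrite mE xE.
  by have <- : m + m = 2 * m by ring.
- rewrite km addNr => iso; right; rewrite distrC mE zE.
  by have <- : - m - m = - (2 * m) by ring.
Qed.

End PlaneForms.

Section RankTwoClassification.
Variable R : realType.
Implicit Types (S M : 'M[R]_3) (x y z a b : R).

Lemma classifiable_rank2 a b : a != 0 -> b != 0 ->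
  (forall x y z, x * z - y ^+ 2 != 0 -> classifiable (rank2_metric x y z a b)) ->
  forall S M, classifiable (metric S M (diag3 0 a b)).
Proof.
move=> a0 b0 plane_class S M; apply: classifiableI => gamma nil.
have [x [y [z iso]]] := isometric_rank2_metric a0 b0 nil.
apply: (isometric_classifiable iso); apply: plane_class.
exact: rank2_metric_det_neq0 (isometric_nilsoliton iso nil).
Qed.

Lemma classifiable_E20 (e : bool) S M : classifiable (metric S M ((-1) ^+ e *: E20 R)).
Proof.
rewrite scale_E20; apply: classifiable_rank2; rewrite ?signr_eq0 // => x y z _.
apply: classifiableI => gamma nil.
have [x' [z' iso]] := rotate_rank2_metric x y z ((-1) ^+ e).
apply: (isometric_classifiable iso).
have := rank2_metric_det_neq0 (isometric_nilsoliton iso nil).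
rewrite expr0n subr0 mulf_eq0 negb_or => /andP[x0 z0].
apply: (@listed_classifiable _ _ 0); rewrite /rank2_metric -scale_E20.
by constructor 3; exact: Family_iii_20.
Qed.

Lemma classifiable_E11_diag x z : classifiable (rank2_metric x 0 z 1 (-1)).
Proof.
apply: classifiableI => gamma /rank2_metric_det_neq0.
rewrite expr0n subr0 mulf_eq0 negb_or => /andP[x0 z0].
apply: (@listed_classifiable _ _ 0).
by constructor 3; exact: Family_iii_11_1.
Qed.

(* On [<e_2, e_3>] the characteristic polynomial of [E11^-1 S] has discriminant
   [(x + z)^2 - (2 y)^2]. *)
Lemma classifiable_E11_discr_gt0 x y z :
  (2 * y) ^+ 2 < (x + z) ^+ 2 -> classifiable (rank2_metric x y z 1 (-1)).
Proof.
move=> /boost_diagonalizes[c [t [ct1 ct0]]].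
have := boost_rank2_metric 1 ct1 (erefl _) (erefl _) (erefl _).
move=> /(_ x y z)/isometric_classifiable; apply.
have -> : x * c * t + y * (c * c + t * t) + z * t * c = 0 by lra.
exact: classifiable_E11_diag.
Qed.

Lemma classifiable_E11_discr_lt0 x y z :
  (x + z) ^+ 2 < (2 * y) ^+ 2 -> classifiable (rank2_metric x y z 1 (-1)).
Proof.
move=> /boost_diagonalizes[c [t [ct1 ct0]]].
have := boost_rank2_metric 1 ct1 (erefl _) (erefl _) (erefl _).
move=> /(_ x y z)/isometric_classifiable; apply.
set X := x * c ^+ 2 + _ + _; set Y := x * c * t + _ + _; set Z := x * t ^+ 2 + _ + _.
have -> : Z = - X by rewrite /Z /X; lra.
have [->|Y0] := eqVneq Y 0; first exact: classifiable_E11_diag.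
apply: (@listed_classifiable _ _ 0).
by constructor 4; exact: Omitted_11.
Qed.

Lemma classifiable_E11_discr_eq0 x y z : x * z - y ^+ 2 != 0 ->
  (x + z) ^+ 2 = (2 * y) ^+ 2 -> classifiable (rank2_metric x y z 1 (-1)).
Proof.
move=> d0 xzE; have xz : x != z.
  apply: contra_neq d0 => xz; have : (2 * x) ^+ 2 = (2 * y) ^+ 2 by rewrite -xzE -xz; ring.
  by rewrite -xz; lra.
wlog y0 : y d0 xzE / 0 < y => [wlog_y|].
  have [y0|y0|->] := ltgtP y 0; [|exact: wlog_y|exact: classifiable_E11_diag].
  apply: isometric_classifiable (flip_rank2_metric x y z 1 (-1)) _.
  by apply: wlog_y; rewrite ?mulrN ?sqrrN ?oppr_gt0.
have [iso|iso] := isometric_lightlike y0 xzE xz; apply: (isometric_classifiable iso);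
  apply: (@listed_classifiable _ _ 0); constructor 3.
- by apply: Family_iii_11_2; rewrite subr_eq0.
- by apply: Family_iii_11_3; rewrite subr_eq0 eq_sym.
Qed.

Lemma classifiable_E11 S M : classifiable (metric S M (E11 R)).
Proof.
apply: classifiable_rank2; rewrite ?oppr_eq0 ?oner_eq0 // => x y z d0.
have [discr|discr|discr] := ltgtP ((2 * y) ^+ 2) ((x + z) ^+ 2).
- exact: classifiable_E11_discr_gt0.
- exact: classifiable_E11_discr_lt0.
- exact: classifiable_E11_discr_eq0.
Qed.

End RankTwoClassification.

Section RankOne.
Variable R : realType.
Implicit Types (S M : 'M[R]_3) (p q r s t u v h : R).

Lemma rank1_minors_neq0 S p q m13 r s m23 u v m33 h gamma :
  nilsoliton (metric S (mat33 p q m13 r s m23 u v m33) (diag3 0 0 h)) gamma ->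
  [\/ r * v - s * u != 0, u * q - v * p != 0 | p * s - q * r != 0].
Proof.
move=> /nilsoliton_metricP[_ _ [P [Q [T [_ /metric_mul_eq1[_ _ _ QT] _]]]]].
move: QT; rewrite diag3E.
case/mat33P: T => ? ? ? ? ? ? ? ? ?; case/mat33P: Q => a b ? c d ? e f ?.
rewrite tr_mat33 !mul_mat33 add_mat33 scalar_mat33 => /mat33_inj[[e11 e12 _] [_ e22 _] _].
have minors : (r * v - s * u) * (c * f - d * e) + (u * q - v * p) * (e * b - f * a)
    + (p * s - q * r) * (a * d - b * c) = 1.
  transitivity ((p * a + r * c + u * e) * (q * b + s * d + v * f)
                - (p * b + r * d + u * f) * (q * a + s * c + v * e)); first by ring.
  have -> : p * a + r * c + u * e = 1 by rewrite -e11; ring.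
  have -> : q * b + s * d + v * f = 1 by rewrite -e22; ring.
  have -> : p * b + r * d + u * f = 0 by rewrite -[RHS]e12; ring.
  by rewrite mul1r mul0r subr0.
have [n1|] := eqVneq (r * v - s * u) 0; last by constructor 1.
have [n2|] := eqVneq (u * q - v * p) 0; last by constructor 2.
constructor 3; apply: contra_eq_neq minors => ->.
by rewrite n1 n2 !mul0r !addr0 eq_sym oner_eq0.
Qed.

Lemma isometric_rank1_flat S p q r s h gamma : p * s - q * r != 0 ->
  nilsoliton (metric S (mat33 p q 0 r s 0 0 0 0) (diag3 0 0 h)) gamma ->
  exists2 t, t != 0 & isometric (metric S (mat33 p q 0 r s 0 0 0 0) (diag3 0 0 h))
                                (rank1_flat_metric t p q r s h).
Proof.
set d := p * s - q * r => d0 nil; pose u : 'cV[R]_3 := col3 0 0 1.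
pose L := mat33 (s / d) (- q / d) 0 (- r / d) (p / d) 0 0 0 0.
have [||||t t0 iso] := nilsoliton_project_line (L := L) (u := u) nil.
- by rewrite diag3E mul_mat33 zero_mat33; congr mat33; ring.
- rewrite mul_mat33 scalar_mat33 opp_mat33 add_mat33 mul_col3_tr.
  by congr mat33; rewrite /d; field.
- by rewrite tr_mat33 mul_mat33_col3 zero_col3; congr col3; ring.
- by apply/eqP; rewrite zero_col3 => /col3_inj[_ _ /eqP]; rewrite oner_eq0.
exists t => //; congr (isometric _ (metric _ _ _)): iso.
by rewrite mul_col3_tr scale_mat33 diag3E; congr mat33; ring.
Qed.

Lemma isometric_rank1 S p q r s h gamma : p * s - q * r != 0 ->
  nilsoliton (metric S (mat33 p q 0 0 0 0 r s 0) (diag3 0 0 h)) gamma ->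
  exists2 t, t != 0 & isometric (metric S (mat33 p q 0 0 0 0 r s 0) (diag3 0 0 h))
                                (rank1_metric t p q r s h).
Proof.
set d := p * s - q * r => d0 nil; pose u : 'cV[R]_3 := col3 0 1 0.
pose L := mat33 (s / d) 0 (- q / d) (- r / d) 0 (p / d) 0 0 0.
have [||||t t0 iso] := nilsoliton_project_line (L := L) (u := u) nil.
- by rewrite diag3E mul_mat33 zero_mat33; congr mat33; ring.
- rewrite mul_mat33 scalar_mat33 opp_mat33 add_mat33 mul_col3_tr.
  by congr mat33; rewrite /d; field.
- by rewrite tr_mat33 mul_mat33_col3 zero_col3; congr col3; ring.
- by apply/eqP; rewrite zero_col3 => /col3_inj[_ /eqP]; rewrite oner_eq0.
exists t => //; congr (isometric _ (metric _ _ _)): iso.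
by rewrite mul_col3_tr scale_mat33 diag3E; congr mat33; ring.
Qed.

Lemma scale_rank1_flat_metric f k t p q r s h : f != 0 -> k != 0 ->
  isometric (rank1_flat_metric t p q r s h)
    (rank1_flat_metric (k ^+ 2 * t) (f * k * p) (f ^+ 2 * k * q) (k * r) (f * k * s)
                       (f ^+ 2 * h)).
Proof.
move=> f0 k0; rewrite /rank1_flat_metric !diag3E.
apply: (isometric_block (B := mat33 f 0 0 0 1 0 0 0 k) (C := 0)).
- by rewrite tr_mat33.
- by rewrite unitmxE unitfE det_mat33 !(mulr0, mul0r, addr0, subr0, mul1r) mulf_neq0.
- by rewrite trmx0 !(mul0mx, mulmx0) !addr0 tr_mat33 !mul_mat33; congr mat33; ring.
- by rewrite trmx0 mul0mx addr0 tr_mat33 cofmx_mat33 !mul_mat33; congr mat33; ring.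
- by rewrite cofmx_mat33 tr_mat33 !mul_mat33; congr mat33; ring.
Qed.

Lemma scale_rank1_metric f n e t p q r s h : f != 0 -> n != 0 -> e != 0 ->
  isometric (rank1_metric t p q r s h)
    (rank1_metric (n ^+ 2 * t) (f * n * e * p) (f ^+ 2 * e * q) (e ^+ 2 * n * r)
                  (e ^+ 2 * f * s) (f ^+ 2 * (n ^+ 2 * h))).
Proof.
move=> f0 n0 e0; rewrite /rank1_metric !diag3E.
apply: (isometric_block (B := mat33 f 0 0 0 n 0 0 0 e) (C := 0)).
- by rewrite tr_mat33.
- by rewrite unitmxE unitfE det_mat33 !(mulr0, mul0r, addr0, subr0) !mulf_neq0.
- by rewrite trmx0 !(mul0mx, mulmx0) !addr0 tr_mat33 !mul_mat33; congr mat33; ring.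
- by rewrite trmx0 mul0mx addr0 tr_mat33 cofmx_mat33 !mul_mat33; congr mat33; ring.
- by rewrite cofmx_mat33 tr_mat33 !mul_mat33; congr mat33; ring.
Qed.

Lemma classifiable_rank1_flat S p q r s h : p * s - q * r != 0 -> h != 0 ->
  classifiable (metric S (mat33 p q 0 r s 0 0 0 0) (diag3 0 0 h)).
Proof.
move=> d0 h0; apply: classifiableI => gamma nil.
have [t t0 iso] := isometric_rank1_flat d0 nil; apply: (isometric_classifiable iso).
have [f /lt0r_neq0 f0 fE] := sqr_scale_sg h; have [k /lt0r_neq0 k0 kE] := sqr_scale_sg t.
apply: (isometric_classifiable (scale_rank1_flat_metric t p q r s h f0 k0)).
rewrite fE kE -!neqr0_sign // /rank1_flat_metric -!scale_E10.
apply: (@listed_classifiable _ _ 0); constructor 4; apply: Omitted_10_flat.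
have -> : f * k * p * (f * k * s) - f ^+ 2 * k * q * (k * r) =
    (f * k) ^+ 2 * (p * s - q * r) by ring.
by rewrite mulf_neq0 // sqrf_eq0 mulf_neq0.
Qed.

Lemma classifiable_rank1_antidiagonal S q r h : q != 0 -> r != 0 -> h != 0 ->
  classifiable (metric S (mat33 0 q 0 0 0 0 r 0 0) (diag3 0 0 h)).
Proof.
move=> q0 r0 h0; apply: classifiableI => gamma nil.
have d0 : 0 * 0 - q * r != 0 by rewrite mul0r sub0r oppr_eq0 mulf_neq0.
have [t t0 iso] := isometric_rank1 d0 nil; apply: (isometric_classifiable iso).
have [k k0 kE] := sqr_scale_sg t; pose n := Num.sg r * k.
have nr : 0 < n * r.
  by rewrite /n mulrAC -normrEsg mulr_gt0 ?normr_gt0.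
have n0 : n != 0 by apply: contraTneq nr => ->; rewrite mul0r ltxx.
have nt : n ^+ 2 * t = (-1) ^+ (t < 0)%R.
  by rewrite neqr0_sign // -kE /n exprMn sqr_sg r0 mul1r.
have [f f0 fE] := sqr_scale_sg (n ^+ 2 * h).
have [e e0 eE] := sqr_scale_sg (n * r); rewrite gtr0_sg // mulrA in eE.
have nh0 : n ^+ 2 * h != 0 by rewrite mulf_neq0 // sqrf_eq0.
apply: (isometric_classifiable
  (scale_rank1_metric t 0 q r 0 h (lt0r_neq0 f0) n0 (lt0r_neq0 e0))).
rewrite nt fE eE !mulr0 -neqr0_sign //.
apply: (isometric_classifiable (isometric_sym (isometric_M1 _ _ _))).
  by rewrite signr_eq0.
rewrite -!scale_E10; apply: (@listed_classifiable _ _ 0); constructor 3.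
by apply: Family_iii_10; rewrite !mulf_neq0 // lt0r_neq0.
Qed.

Lemma classifiable_rank1_diagonal S p s h : p != 0 -> s != 0 -> h != 0 ->
  classifiable (metric S (mat33 p 0 0 0 0 0 0 s 0) (diag3 0 0 h)).
Proof.
move=> p0 s0 h0; apply: classifiableI => gamma nil.
have d0 : p * s - 0 * 0 != 0 by rewrite mul0r subr0 mulf_neq0.
have [t t0 iso] := isometric_rank1 d0 nil; apply: (isometric_classifiable iso).
have [n /lt0r_neq0 n0 nE] := sqr_scale_sg t.
have [f /lt0r_neq0 f0 fE] := sqr_scale_sg (n ^+ 2 * h).
have nh0 : n ^+ 2 * h != 0 by rewrite mulf_neq0 // sqrf_eq0.
pose e := (f * n * p)^-1; have e0 : e != 0 by rewrite invr_eq0 !mulf_neq0.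
apply: (isometric_classifiable (scale_rank1_metric t p 0 0 s h f0 n0 e0)).
have -> : f * n * e * p = 1 by rewrite /e; field; rewrite f0 n0 p0.
rewrite nE fE !mulr0 -!neqr0_sign //; apply: (@listed_classifiable _ _ 0); constructor 4.
have := Omitted_10 (t < 0) (n ^+ 2 * h < 0) (l := e ^+ 2 * f * s).
by rewrite scale_E10 scale_diag3 mulr0 mulr1; apply; rewrite !mulf_neq0 ?sqrf_eq0.
Qed.

Lemma classifiable_rank1_pairing S p q r s h : p * s - q * r != 0 -> h != 0 ->
  classifiable (metric S (mat33 p q 0 0 0 0 r s 0) (diag3 0 0 h)).
Proof.
move=> d0 h0; have ET : (diag3 0 0 h)^T = diag3 0 0 h by rewrite diag3E tr_mat33.
have [r0|r0] := eqVneq r 0.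
  have [p0 s0] : p != 0 /\ s != 0.
    by apply/andP; rewrite -negb_or -mulf_eq0; move: d0; rewrite r0 mulr0 subr0.
  have diag : pairing_equiv (mat33 p q 0 0 0 0 r s 0) (diag3 0 0 h)
                            (mat33 p 0 0 0 0 0 0 s 0) (diag3 0 0 h).
    exists (mat33 1 0 0 0 1 0 (- q / s) 0 1), (mat33 0 0 0 0 0 0 (- (q * p) / (s * h)) 0 0).
    rewrite unitmxE unitfE det_mat33 diag3E r0 cofmx_mat33 !tr_mat33 !mul_mat33 add_mat33.
    rewrite !mul_mat33.
    split; [|by congr mat33; field; rewrite ?s0 ?h0|by congr mat33; field].
    by rewrite !(mulr0, mul0r, addr0, subr0, mul1r) oner_eq0.
  apply: (pairing_equiv_classifiable ET diag) => S'.
  exact: classifiable_rank1_diagonal.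
have antidiag : pairing_equiv (mat33 p q 0 0 0 0 r s 0) (diag3 0 0 h)
    (mat33 0 (q - p * s / r) 0 0 0 0 r 0 0) (diag3 0 0 h).
  exists (mat33 1 0 0 (s / r) 1 0 (- p / r) 0 1), (mat33 0 0 0 0 0 0 0 0 (- p / h)).
  rewrite unitmxE unitfE det_mat33 diag3E cofmx_mat33 !tr_mat33 !mul_mat33 add_mat33 !mul_mat33.
  split; [|by congr mat33; field; rewrite ?r0 ?h0|by congr mat33; field].
  by rewrite !(mulr0, mul0r, addr0, subr0, mul1r) oner_eq0.
apply: (pairing_equiv_classifiable ET antidiag) => S'.
apply: classifiable_rank1_antidiagonal => //.
apply: contra_neq d0 => q'0; have -> : p * s - q * r = - (q - p * s / r) * r by field.
by rewrite q'0 oppr0 mul0r.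
Qed.

(* The cross product [n] of the first two columns is annihilated by the pairing; the change
   of basis sends [e_2] to [n]. *)
Lemma pairing_equiv_annihilator p q r s u v h :
  let n1 := r * v - s * u in let n2 := u * q - v * p in
  n1 ^+ 2 + n2 ^+ 2 != 0 -> h != 0 ->
  exists p' q' r' s', p' * s' - q' * r' != 0 /\
    pairing_equiv (mat33 p q 0 r s 0 u v 0) (diag3 0 0 h) (mat33 p' q' 0 0 0 0 r' s' 0)
      (diag3 0 0 (h * (n1 ^+ 2 + n2 ^+ 2) ^+ 2)).
Proof.
move=> n1 n2; set D := n1 ^+ 2 + n2 ^+ 2 => D0 h0; pose n3 := p * s - q * r.
pose a := n2 * p - n1 * r; pose b := n2 * q - n1 * s.
exists (n2 * a - n1 * b), (n1 * a + n2 * b), (n2 * u - n1 * v), (n1 * u + n2 * v); split.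
  have -> : (n2 * a - n1 * b) * (n1 * u + n2 * v) - (n1 * a + n2 * b) * (n2 * u - n1 * v) =
      - D ^+ 2 by rewrite /a /b /D /n1 /n2; ring.
  by rewrite oppr_eq0 sqrf_eq0.
exists (mat33 n2 n1 0 (- n1) n2 0 0 n3 1).
exists (mat33 0 0 0 0 0 0 (n3 * (n1 * a + n2 * b) / (h * D)) 0
              (n3 * (n1 * u + n2 * v) / (h * D))).
rewrite unitmxE unitfE det_mat33 !diag3E !tr_mat33 cofmx_mat33 tr_mat33 !mul_mat33 add_mat33.
rewrite mul_mat33.
split.
- by have -> : n2 * (n2 * 1 - 0 * n3) + n1 * (0 * 0 - - n1 * 1) + 0 * (- n1 * n3 - n2 * 0) = D
    by rewrite /D; ring.
- by congr mat33; first [rewrite /a /b; ring|rewrite /n1 /n2 /n3; ring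
    |rewrite /a /b /D; field; rewrite -/D D0 h0].
- by congr mat33; rewrite /D; ring.
Qed.

Lemma classifiable_rank1_columns S p q r s u v h :
  [\/ r * v - s * u != 0, u * q - v * p != 0 | p * s - q * r != 0] -> h != 0 ->
  classifiable (metric S (mat33 p q 0 r s 0 u v 0) (diag3 0 0 h)).
Proof.
set n1 := r * v - s * u; set n2 := u * q - v * p; set n3 := p * s - q * r => n0 h0.
have ET : (diag3 0 0 h)^T = diag3 0 0 h by rewrite diag3E tr_mat33.
have [D0|D0] := eqVneq (n1 ^+ 2 + n2 ^+ 2) 0; last first.
  have [p' [q' [r' [s' [d0 annih]]]]] := pairing_equiv_annihilator D0 h0.
  apply: (pairing_equiv_classifiable ET annih) => S'.
  by apply: classifiable_rank1_pairing; rewrite ?mulf_neq0 ?sqrf_eq0.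
have [n10 n20] : n1 = 0 /\ n2 = 0.
  by move/eqP: D0; rewrite paddr_eq0 ?sqr_ge0 // !sqrf_eq0 => /andP[/eqP -> /eqP ->].
have n30 : n3 != 0 by case: n0; rewrite ?n10 ?n20 ?eqxx.
have u0 : u = 0.
  apply: (mulIf n30); rewrite mul0r.
  have -> : u * n3 = - (p * n1 + r * n2) by rewrite /n1 /n2 /n3; ring.
  by rewrite n10 n20 !mulr0 addr0 oppr0.
have v0 : v = 0.
  apply: (mulIf n30); rewrite mul0r.
  have -> : v * n3 = - (q * n1 + s * n2) by rewrite /n1 /n2 /n3; ring.
  by rewrite n10 n20 !mulr0 addr0 oppr0.
by rewrite u0 v0; exact: classifiable_rank1_flat.
Qed.

Lemma classifiable_rank1 S M h : h != 0 -> classifiable (metric S M (diag3 0 0 h)).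
Proof.
move=> h0; apply: classifiableI => gamma.
case/mat33P: M => p q m13 r s m23 u v m33 /rank1_minors_neq0 n0.
apply: (@pairing_equiv_classifiable _ _ _ (mat33 p q 0 r s 0 u v 0) (diag3 0 0 h)) S.
- by rewrite diag3E tr_mat33.
- apply: (pairing_equiv_shear (C := mat33 0 0 0 0 0 0 (- m13 / h) (- m23 / h) (- m33 / h))).
  by rewrite diag3E tr_mat33 mul_mat33 add_mat33; congr mat33; field.
by move=> S; exact: classifiable_rank1_columns.
Qed.

End RankOne.

Lemma classifiable_rank0 (R : realType) (S M : 'M[R]_3) : classifiable (metric S M 0).
Proof.
apply: classifiableI => gamma nil.
have [ST E0 [P [Q [T [_ ginv _]]]]] := (nilsoliton_metricP _ _ _ _).1 nil.
have [_ _ _ MQ] := (metric_mul_eq1 _ _ _ _ _ _).1 ginv.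
have uM : M \in unitmx by move: MQ; rewrite mul0mx addr0 -unitmx_tr => /mulmx1_unit[].
have := isometric_project M ST E0 (mul0mx _ (invmx M)).
rewrite mulmxV // subrr !mul0mx => /isometric_classifiable; apply.
by apply: (@listed_classifiable _ _ 0); constructor 4; exact: Omitted_00.
Qed.

Lemma inertia_form_classifiable (R : realType) (S M E : 'M[R]_3) :
  inertia_form E -> classifiable (metric S M E).
Proof.
case=> [b|b|b||b|]; [exact: classifiable_E30|exact: classifiable_E21|exact: classifiable_E20
  |exact: classifiable_E11| |exact: classifiable_rank0].
by rewrite scale_E10; apply: classifiable_rank1; rewrite signr_eq0.
Qed.

Lemma nilsoliton_classification (R : realType) (g : 'M[R]_6) gamma :
  nilsoliton g gamma -> exists2 h, listed h gamma & isometric g h.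
Proof.
suff : classifiable g by apply.
apply: classifiableI => gamma' nil; have [[gT _] _] := nil.
rewrite (metric_eta gT); set S := ulsubmx _; set M := ursubmx _; set E := drsubmx _.
have ET : E^T = E by rewrite /E trmx_drsub gT.
have [F EF formF] := sym_has_inertia_form ET.
have [M' MM'] := congruent_pairing_equiv M EF.
apply: (pairing_equiv_classifiable ET MM') => S'.
exact: inertia_form_classifiable.
Qed.

Theorem proposition4p6 (R : realType) :
  [/\ forall (h : 'M[R]_6) (gamma : R), family_i h gamma -> expanding h gamma,
      forall (h : 'M[R]_6) (gamma : R), family_ii h gamma -> shrinking h gamma,
      forall (h : 'M[R]_6) (gamma : R), family_iii h gamma -> steady h gamma
    & forall (g : 'M[R]_6) (gamma : R),
        nilsoliton g gamma <->
        exists2 h : 'M[R]_6,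
          [\/ family_i h gamma, family_ii h gamma, family_iii h gamma
            | omitted_family h gamma]
          & isometric g h].
Proof.
have gamma_gt0 (l : R) : l != 0 -> 0 < 5 / (2 * l ^+ 2).
  by move=> l0; rewrite divr_gt0 ?ltr0n // mulr_gt0 ?ltr0n // exprn_even_gt0.
split=> [h gamma fh|h gamma fh|h gamma fh|g gamma].
- by split; [exact: family_i_nilsoliton|case: fh => l l0; rewrite oppr_lt0 gamma_gt0].
- by split; [exact: family_ii_nilsoliton|case: fh => l l0; exact: gamma_gt0].
- by split; [exact: family_iii_nilsoliton|case: fh].
split=> [/nilsoliton_classification//|[h hl gh]].
exact: isometric_nilsoliton (isometric_sym gh) (listed_nilsoliton hl).
Qed.
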